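(* Let $n\ge1$ and let $Y_n=Y_n(C)$ be an oriented real Bott manifold associated to a Bott matrix $C\in M_n(\mathbb Z_2)$. Then $Y_n$ is orientedly null-cobordant, i.e. $Y_n$ is diffeomorphic, as an oriented manifold, to the boundary of some compact smooth oriented $(n+1)$-dimensional manifold with boundary.
   Context: A Bott matrix is a strictly upper triangular matrix $C=(c_{i,j})\in M_n(\mathbb Z_2)$. The associated real Bott manifold $Y_n(C)$ is the closed smooth $n$-manifold given by the real part of the smooth complete complex toric variety whose fan in $\mathbb R^n$ is as follows: choose integers $a_{i,j}$ ($i<j$) with $a_{i,j}\equiv c_{i,j}\bmod 2$, put $v_j=e_j$ and $v_{n+j}=-e_j+\sum_{k=j+1}^n a_{j,k}e_k$ for $1\le j\le n$; the cones are those generated by subsets of $\{v_1,\dots,v_{2n}\}$ containing no pair $\{v_i,v_{n+i}\}$. Equivalently, it is the small cover over the cube $I^n$: with facets $F_1,\dots,F_{2n}$ ($F_j$ and $F_{n+j}$ opposite), $\lambda(F_j)=e_j$ and $\lambda(F_{n+j})=e_j+\sum_{k=j+1}^n c_{j,k}e_k\in\mathbb Z_2^n$ for $1\le j\le n$, $Y_n(C)=(\mathbb Z_2^n\times I^n)/\!\sim$, where $(t,p)\sim(t',p')$ iff $p=p'$ and $t-t'$ lies in the span of the $\lambda(F)$ over the facets $F$ containing $p$. It is an iterated $\mathbb{RP}^1$-bundle. An oriented real Bott manifold is an orientable one equipped with an orientation. *)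

(* Defs.v *)
From HB Require Import structures.
From mathcomp Require Import all_boot all_order all_algebra.
From mathcomp Require Import all_classical all_reals all_analysis.

Set Implicit Arguments.
Unset Strict Implicit.
Unset Printing Implicit Defensive.

Import Order.TTheory GRing.Theory Num.Theory.
Import numFieldNormedType.Exports.

Local Open Scope classical_set_scope.
Local Open Scope ring_scope.

Section Smooth.
Context {R : realType} {n m : nat}.

Fixpoint Ck (k : nat) (U : set 'rV[R]_n) (f : 'rV[R]_n -> 'rV[R]_m) : Prop :=
  if k is k'.+1 then
    (forall x, U x -> differentiable f x) /\ (forall v, Ck k' U ('D_v f))
  else forall x, U x -> {for x, continuous f}.

Definition Cinfty (U : set 'rV[R]_n) (f : 'rV[R]_n -> 'rV[R]_m) : Prop :=
  forall k, Ck k U f.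

(* [g], smooth on the open set [U] around [a p], expresses the coordinates [b]
   as a function of the coordinates [a], at the points of [D] that [a] sends
   into [U].  As [a] may only reach part of [U], such as its intersection with
   a half-space, this is the usual notion of smoothness on a non-open set:
   local extension to a smooth function on an open set. *)
Definition local_expr (T : Type) (D : set T) (a : T -> 'rV[R]_n)
    (b : T -> 'rV[R]_m) (p : T) (U : set 'rV[R]_n)
    (g : 'rV[R]_n -> 'rV[R]_m) : Prop :=
  [/\ open U, U (a p), Cinfty U g &
      forall q, D q -> U (a q) -> g (a q) = b q].

Definition smooth_at (T : Type) (D : set T) (a : T -> 'rV[R]_n)
    (b : T -> 'rV[R]_m) (p : T) : Prop :=
  exists U g, local_expr D a b p U g.

End Smooth.

(* At a boundary point of a half-space the differential of [g] is determined by
   the values of [g] on the half-space. *)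
Definition positive_at {R : realType} {n : nat} (T : Type) (D : set T)
    (a b : T -> 'rV[R]_n) (p : T) : Prop :=
  exists U g, local_expr D a b p U g /\ 0 < \det (jacobian g (a p)).

Record chart (R : realType) (T : Type) (n : nat) := Chart {
  cdom : set T;
  cmap :> T -> 'rV[R]_n  (* only meaningful on [cdom] *)
}.

Section Atlas.
Context {R : realType} {T : topologicalType} {n : nat}.
Implicit Types (M : set 'rV[R]_n) (c : chart R T n) (A : set (chart R T n)).

(* [c] is a homeomorphism from [cdom c] onto a relatively open subset of [M] *)
Definition is_chart M c : Prop :=
  [/\ open (cdom c),
      {in cdom c &, injective c},
      forall p, cdom c p -> {for p, continuous c} &
      forall O, open O -> O `<=` cdom c ->
        exists2 V, open V & c @` O = V `&` M].

Definition covering A : Prop := forall p, exists2 c, A c & cdom c p.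

Definition smooth_atlas M A : Prop :=
  [/\ forall c, A c -> is_chart M c,
      covering A &
      forall c1 c2, A c1 -> A c2 ->
        forall p, (cdom c1 `&` cdom c2) p ->
          smooth_at (cdom c1 `&` cdom c2) c1 c2 p].

Definition oriented_atlas M A : Prop :=
  [/\ forall c, A c -> is_chart M c,
      covering A &
      forall c1 c2, A c1 -> A c2 ->
        forall p, (cdom c1 `&` cdom c2) p ->
          positive_at (cdom c1 `&` cdom c2) c1 c2 p].

(* An orientation of the smooth manifold given by the atlas [A0] is represented
   by an oriented atlas of the same smooth structure. *)
Definition orientation M A0 A : Prop :=
  oriented_atlas M A /\ smooth_atlas M (A0 `|` A).

End Atlas.

Definition oriented_diffeomorphic {R : realType} {T1 T2 : topologicalType}
    {n : nat} (A1 : set (chart R T1 n)) (A2 : set (chart R T2 n)) : Prop :=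
  exists (f : T1 -> T2) (g : T2 -> T1),
    [/\ cancel f g, cancel g f, continuous f, continuous g &
        forall c1 c2, A1 c1 -> A2 c2 ->
          let D1 := cdom c1 `&` f @^-1` cdom c2 in
          let D2 := cdom c2 `&` g @^-1` cdom c1 in
          (forall p, D1 p -> positive_at D1 c1 (c2 \o f) p) /\
          (forall q, D2 q -> smooth_at D2 c2 (c1 \o g) q)].

(* The first coordinate is nonpositive, so that it points outwards along the
   boundary: with the outward-normal-first convention, dropping it from the
   charts of an oriented atlas yields an oriented atlas of the boundary.  Used
   here for dimension n.+1 >= 2 only: with this single model an oriented compact
   interval would have no oriented atlas. *)
Definition half_space (R : realType) (n : nat) : set 'rV[R]_n.+1 :=
  [set x | x ord0 ord0 <= 0].

Section Boundary.
Context {R : realType} {T : topologicalType} {n : nat}.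
Implicit Type B : set (chart R T n.+1).

Definition boundary B : set T :=
  [set p | exists c, [/\ B c, cdom c p & c p ord0 ord0 = 0]].

Definition boundary_chart B (c : chart R T n.+1) :
    chart R (set_type (boundary B)) n :=
  Chart [set q | cdom c (set_val q)]
        (fun q => \row_i c (set_val q) ord0 (lift ord0 i)).

Definition boundary_atlas B : set (chart R (set_type (boundary B)) n) :=
  [set boundary_chart B c | c in B].

End Boundary.

Arguments boundary_chart {R T n} B c.
Arguments boundary_atlas {R T n} B.

Definition oriented_null_cobordant {R : realType} {T : topologicalType}
    {n : nat} (A : set (chart R T n)) : Prop :=
  exists (W : topologicalType) (B : set (chart R W n.+1)),
    [/\ hausdorff_space W, @second_countable W, compact [set: W],
        oriented_atlas (@half_space R n) B &
        oriented_diffeomorphic A (boundary_atlas B)].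

Definition bott_matrix (n : nat) (C : 'M['F_2]_n) : Prop :=
  forall i j : 'I_n, (j <= i)%N -> C i j = 0.

(* Only the entries above the diagonal of an integral lift are ever used. *)
Definition integral_lift (n : nat) (C : 'M['F_2]_n) (a : 'M[int]_n) : Prop :=
  forall i j : 'I_n, (i < j)%N -> (a i j)%:~R = C i j.

Section BottFan.
Context {n : nat} (a : 'M[int]_n).

(* the rays v_j (for [false]) and v_{n+j} (for [true]) *)
Definition bott_ray (j : 'I_n) (b : bool) : 'rV[int]_n :=
  if b then - delta_mx ord0 j + \sum_(k < n | (j < k)%N) a j k *: delta_mx ord0 k
  else delta_mx ord0 j.

(* A maximal cone contains exactly one ray of each pair {v_j, v_{n+j}}. *)
Definition bott_cone : Type := {ffun 'I_n -> bool}.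
HB.instance Definition _ := Finite.on bott_cone.

Definition cone_gens (s : bott_cone) : 'M[int]_n :=
  \matrix_(j < n) bott_ray j (s j).

(* Column i is the i-th vector of the basis dual to the generators of [s]. *)
Definition dual_gens (s : bott_cone) : 'M[int]_n := invmx (cone_gens s).

Lemma cone_gens_unit s : cone_gens s \in unitmx.
Proof.
have neq (i j : 'I_n) : (i < j)%N -> (i == j) = false.
  by move=> ij; apply/negbTE; rewrite -val_eqE /= neq_ltn ij.
have tri : is_trig_mx (cone_gens s)^T.
  apply/is_trig_mxP => i j ij; rewrite !mxE /bott_ray.
  case: (s j); rewrite !mxE ?eqxx (neq _ _ ij) // oppr0 add0r summxE.
  by rewrite big1 // => k jk; rewrite !mxE (neq _ _ (ltn_trans ij jk)) andbF mulr0.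
rewrite unitmxE -det_tr det_trig //.
apply: rpred_prod => i _; rewrite !mxE /bott_ray.
case: (s i); rewrite !mxE !eqxx ?unitr1 // summxE big1 ?addr0 ?unitrN ?unitr1 //.
by move=> k ik; rewrite !mxE (neq _ _ ik) andbF mulr0.
Qed.

(* The affine chart of the cone [s] is F^n, with coordinates the characters of
   the dual basis; if m is the i-th vector dual to [t], then this character is
   the monomial of exponents <w_j, m> in the coordinates of [s], for w_j the
   generators of [s]. *)
Definition exponents (s t : bott_cone) : 'M[int]_n :=
  cone_gens s *m dual_gens t.

Definition coord_change (F : fieldType) (s t : bott_cone) (x : 'rV[F]_n) :
    'rV[F]_n :=
  \row_i \prod_(j < n) x ord0 j ^ exponents s t j i.

Section Glue.
Variable F : fieldType.
Implicit Types s t u : bott_cone.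

(* The charts of [s] and [t] are glued along the chart of their common face,
   where the coordinates of the generators of [s] not in [t] are nonzero. *)
Definition bott_glue : rel {s : bott_cone & 'rV[F]_n} := fun p q =>
  [forall j, (tag p j != tag q j) ==> (tagged p ord0 j != 0)]
  && (tagged q == coord_change (tag p) (tag q) (tagged p)).

Lemma exponents_shared s t j i :
  s j = t j -> exponents s t j i = (j == i)%:R.
Proof.
move=> stj; have -> : (j == i)%:R = (1%:M : 'M[int]_n) j i by rewrite mxE.
rewrite -(mulmxV (cone_gens_unit t)) !mxE.
by apply: eq_bigr => k _; rewrite !mxE stj.
Qed.

Lemma exponentsM s t u : exponents s t *m exponents t u = exponents s u.
Proof. by rewrite /exponents mulmxA mulmxKV ?cone_gens_unit. Qed.

Lemma exponentsxx s : exponents s s = 1%:M.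
Proof. by rewrite /exponents mulmxV ?cone_gens_unit. Qed.

Lemma coord_changexx s (x : 'rV[F]_n) : coord_change s s x = x.
Proof.
apply/rowP => i; rewrite mxE exponentsxx (bigD1 i) //= mxE eqxx expr1z.
by rewrite big1 ?mulr1 // => j /negPf ji; rewrite mxE ji expr0z.
Qed.

Lemma coord_change_neq0 s t (x : 'rV[F]_n) j :
  (forall k, s k != t k -> x ord0 k != 0) -> s j = t j ->
  (coord_change s t x ord0 j != 0) = (x ord0 j != 0).
Proof.
move=> st sj; rewrite mxE (bigD1 j) //= exponents_shared // eqxx expr1z.
rewrite mulf_eq0 negb_or; apply: andb_idr => _.
apply/prodf_neq0 => k kj; have [sk|sk] := eqVneq (s k) (t k).
  by rewrite exponents_shared // (negPf kj) expr0z oner_neq0.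
by rewrite expfz_neq0 // st.
Qed.

Lemma coord_change_neq s t (x : 'rV[F]_n) j :
  (forall k, s k != t k -> x ord0 k != 0) -> s j != t j ->
  coord_change s t x ord0 j != 0.
Proof.
move=> st sj; rewrite mxE; apply/prodf_neq0 => k _.
have [sk|sk] := eqVneq (s k) (t k); last by rewrite expfz_neq0 // st.
have kj : k != j by apply: contraNneq sj => <-; rewrite sk.
by rewrite exponents_shared // (negPf kj) expr0z oner_neq0.
Qed.

Lemma coord_change_comp s t u (x : 'rV[F]_n) :
    (forall k, s k != t k -> x ord0 k != 0) ->
    (forall k, t k != u k -> coord_change s t x ord0 k != 0) ->
  coord_change t u (coord_change s t x) = coord_change s u x.
Proof.
move=> st tu; apply/rowP => i; rewrite !mxE.
have prodX (I : finType) (G : I -> F) (z : int) :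
    (\prod_j G j) ^ z = \prod_j G j ^ z.
  by apply: (big_morph (fun y => y ^ z)) => [y y'|];
     [exact: expfzMl | exact: exp1rz].
under eq_bigr => k _ do rewrite mxE prodX.
rewrite exchange_big; apply: eq_bigr => j _ /=.
have [xj0|xj0] := eqVneq (x ord0 j) 0; last first.
  rewrite -(exponentsM s t u) mxE.
  rewrite (big_morph (fun z : int => x ord0 j ^ z)
    (fun z z' => expfzDr z z' xj0) (expr0z _)).
  by apply: eq_bigr => k _; rewrite exprz_exp.
have sj : s j = t j by apply/eqP; apply: contraTT (eqxx (x ord0 j)) => /st;
  rewrite xj0 eqxx.
have tj : t j = u j.
  apply/eqP; apply: contraTT (eqxx (x ord0 j)) => /tu.
  by rewrite coord_change_neq0 // xj0 eqxx.
rewrite (bigD1 j) //= big1 => [|k kj]; last first.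
  by rewrite exponents_shared // eq_sym (negPf kj) expr0z exp1rz.
rewrite mulr1 (exponents_shared _ sj) eqxx expr1z.
by rewrite (exponents_shared _ tj) (exponents_shared _ (etrans sj tj)).
Qed.

Lemma bott_glueP (p q : {s : bott_cone & 'rV[F]_n}) :
  reflect ((forall j, tag p j != tag q j -> tagged p ord0 j != 0) /\
           tagged q = coord_change (tag p) (tag q) (tagged p))
          (bott_glue p q).
Proof.
apply: (iffP andP) => [[/forallP pq /eqP ->]|[pq ->]]; split=> //.
  by move=> j; apply/implyP.
by apply/forallP => j; apply/implyP/pq.
Qed.

Lemma bott_glue_refl : reflexive bott_glue.
Proof.
by move=> p; apply/bott_glueP; rewrite coord_changexx; split=> // j; rewrite eqxx.
Qed.

Lemma bott_glue_trans : transitive bott_glue.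
Proof.
move=> [t y] [s x] [u z] /bott_glueP/=[st ->] /bott_glueP/=[tu ->].
apply/bott_glueP; split=> /= [j|]; last by rewrite coord_change_comp.
have [sj|/st//] := eqVneq (s j) (t j); rewrite sj => /tu.
by rewrite coord_change_neq0.
Qed.

Lemma bott_glue_sym : symmetric bott_glue.
Proof.
suff sym p q : bott_glue p q -> bott_glue q p by move=> p q; apply/idP/idP => /sym.
move: p q => [s x] [t y] /bott_glueP/=[st ->]; apply/bott_glueP => /=.
have ts j : t j != s j -> coord_change s t x ord0 j != 0.
  by rewrite eq_sym; apply: coord_change_neq.
by split=> //; rewrite coord_change_comp // coord_changexx.
Qed.

Definition bott_glue_equiv :=
  EquivRel _ bott_glue_refl bott_glue_sym bott_glue_trans.

(* F-points of the toric variety of the Bott fan of [a] *)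
Definition bott_variety : Type := {eq_quot bott_glue_equiv}%qT.
HB.instance Definition _ := Quotient.on bott_variety.
HB.instance Definition _ := Choice.on bott_variety.

End Glue.
End BottFan.

Section RealBott.
Variables (R : realType) (n : nat) (a : 'M[int]_n).

(* The gluing maps being defined over the integers, complex conjugation of the
   complex toric variety acts coordinatewise in the affine charts: the real part
   consists of the R-points. *)
Definition real_bott : Type := bott_variety a R.
HB.instance Definition _ := Quotient.on real_bott.
HB.instance Definition _ := Topological.copy real_bott (quotient_topology real_bott).

Definition affine_chart (s : bott_cone) (x : 'rV[R]_n) : real_bott :=
  (\pi_real_bott (existT (fun=> 'rV[R]_n) s x))%qT.

Definition bott_chart (s : bott_cone) : chart R real_bott n :=
  Chart (range (affine_chart s))
        (fun p => xget 0 [set x | affine_chart s x = p]).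

Definition bott_atlas : set (chart R real_bott n) := range bott_chart.

End RealBott.

Arguments affine_chart {R n} a s x.
Arguments bott_chart R {n} a s.
Arguments bott_atlas R {n} a.

(* Main.v *)
(** The last coordinate makes Y_n an RP^1-bundle over Y_(n-1) whose transition
    maps are z |-> c z^(+-1) with c real.  They also act on CP^1, and commute
    with complex conjugation; let W be the quotient of the resulting
    CP^1-bundle over Y_(n-1) by fibrewise conjugation.  Each fibre CP^1/conj is
    a closed disc with boundary RP^1, so W is compact with boundary Y_n, and the
    affine chart R^n of a cone extends to a chart {h <= 0} x R^n of W, where
    x_n + i h is the complex last coordinate.

    Every change of cones is a composite of flips of a single bit j.  If j < n,
    the Jacobian determinant of the flip on W is a positive multiple of that on
    Y_n; if j = n, both are negative.  The given orientation of Y_n differs from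
    each (connected) affine chart by a constant sign, and the same signs
    therefore orient W. *)

Require Import Defs.
From HB Require Import structures.
From mathcomp Require Import all_boot all_order all_algebra perm.
From mathcomp Require Import all_classical all_reals all_analysis.
From mathcomp Require Import complex ring lra.

Set Implicit Arguments.
Unset Strict Implicit.
Unset Printing Implicit Defensive.

Import Order.TTheory GRing.Theory Num.Theory.
Import numFieldNormedType.Exports.

Local Open Scope classical_set_scope.
Local Open Scope ring_scope.

(** * Calculus of smooth maps *)

(** The last coordinate is the one to complexify because the exponent matrices are triangular: the
    other coordinates never depend on it, while it is kept or inverted and multiplied by a monomial
    in them, which stays real.

    A factor c < 0 and the inversion z |-> 1/z both exchange the two half-planes, so each is
    followed by a conjugation to stay in h <= 0. The factor then acts on h by |c|, which is the
    positive multiple of the overview; the inversion becomes z / |z|^2, the reflection in the unit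
    circle, which reverses orientation just as x |-> 1/x does on the real line.

    The sign of an affine chart is absorbed by its last real coordinate x_n rather than by h: the
    half-space is preserved, and the boundary chart receives the same correction.

    W is glued from full copies of R^(n+1), so its topology is not given by half-space charts. It is
    recovered from the fact that each parametrization [cell] is an open map, which in turn rests on
    the local transition maps. *)

Lemma differentiable_near_eq (R : numFieldType) (V W : normedModType R)
    (f g : V -> W) (x : V) :
  (\near x, f x = g x) -> differentiable f x -> differentiable g x.
Proof.
move=> fg df; have -> : g = f + (g - f) by rewrite addrC subrK.
apply: differentiableD => //.
(* [e] vanishes near [x], so it is its own little-o remainder and has differential zero. *)
set e := g - f.
have e0 : \near x, e x = 0.
  by apply: filterS fg => y fg; rewrite /e !fctE -fg subrr.
have oe : [o_ (0:V) id of e \o shift x] = e \o shift x.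
  apply: littleoE => d d0; move: e0; rewrite (near_shift 0) subr0.
  by apply: filterS => h /= ->; rewrite normr0; apply: mulr_ge0; [exact: ltW|exact: normr_ge0].
have E : e \o shift x = cst (e x) + (\0 : V -> W) +o_ (0:V) id.
  have -> : cst (e x) + (\0 : V -> W) = 0.
    by rewrite (nbhs_singleton e0) funeqE => h /=; rewrite !fctE /= addr0.
  by apply/eqaddoE; rewrite add0r; apply/esym; exact: oe.
apply/diff_locallyP.
have c0 : continuous (\0 : V -> W) by exact: cst_continuous.
have d0 := @diff_unique R V W e \0 x c0 E.
by rewrite d0; split.
Unshelve. all: by end_near. Qed.

Section SmoothScalar.
Context {R : realType} {n : nat}.
Implicit Types (U : set 'rV[R]_n) (f g : 'rV[R]_n -> R).

(* [Ck] for scalar functions *)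
Fixpoint Ckr (k : nat) U f : Prop :=
  if k is k'.+1 then
    (forall x, U x -> differentiable f x) /\ (forall v, Ckr k' U ('D_v f))
  else forall x, U x -> {for x, continuous f}.

Lemma Ckr_ext k U f g : open U -> (forall x, U x -> f x = g x) ->
  Ckr k U f -> Ckr k U g.
Proof.
move=> oU; have nearU (P : set 'rV[R]_n) x : (forall y, U y -> P y) -> U x -> nbhs x P.
  by move=> UP Ux; apply: (filterS UP); exact: open_nbhs_nbhs.
elim: k f g => [|k IH] f g fg /=.
  move=> cf x Ux; rewrite /continuous_at /prop_for -fg //.
  apply: cvg_trans (cf x Ux); apply: near_eq_cvg; first exact: (nbhs_filter x).
  by apply: nearU Ux => y /fg.
move=> [df Df]; split=> [x Ux|v].
  by apply: differentiable_near_eq (df x Ux); apply: nearU Ux => y /fg.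
apply: IH (Df v) => x Ux; apply: near_eq_derive.
by apply: nearU Ux => y /fg.
Qed.

Lemma CkrW k U f : Ckr k.+1 U f -> Ckr k U f.
Proof.
elim: k f => [|k IH] f [df Df]; first by move=> x /df/differentiable_continuous.
by split=> // v; apply: IH; exact: Df.
Qed.

Lemma Ckr_sub k U (V : set 'rV[R]_n) f : V `<=` U -> Ckr k U f -> Ckr k V f.
Proof.
move=> VU; elim: k f => [|k IH] f /=; first by move=> cf x /VU/cf.
by move=> [df Df]; split=> [x /VU/df//|v]; apply: IH.
Qed.

Lemma Ckr_cst k U (c : R) : Ckr k U (cst c).
Proof.
elim: k c => [|k IH] c; first by move=> x _; exact: cst_continuous.
split=> [x _|v]; first exact: differentiable_cst.
have -> : 'D_v (cst c) = cst 0 :> ('rV[R]_n -> R).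
  by apply/funext => x; rewrite derive_cst.
exact: IH.
Qed.

Lemma Ckr_coord k U (i : 'I_n) : Ckr k U (fun x => x ord0 i).
Proof.
case: k => [x _|k]; first exact: coord_continuous.
split=> [x _|v]; first exact: differentiable_coord.
have -> : 'D_v (fun x : 'rV[R]_n => x ord0 i : R) = cst (v ord0 i).
  apply/funext => x; have := @derive_mx R _ 1 n (@id 'rV[R]_n) x v (@derivable_id _ _ x v).
  by rewrite derive_id => /matrixP /(_ ord0 i); rewrite mxE.
exact: Ckr_cst.
Qed.

Lemma CkrD k U f g : open U -> Ckr k U f -> Ckr k U g -> Ckr k U (fun x => f x + g x).
Proof.
move=> oU; elim: k f g => [|k IH] f g; first by move=> cf cg x Ux;
  exact: continuousD (cf x Ux) (cg x Ux).
move=> [df Df] [dg Dg]; split=> [x Ux|v].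
  by apply: differentiableD; [exact: df|exact: dg].
apply: (@Ckr_ext _ _ (fun x => 'D_v f x + 'D_v g x)) => // [x Ux|].
  by rewrite [RHS]deriveD //; apply: diff_derivable; [exact: df|exact: dg].
by apply: IH; [exact: Df|exact: Dg].
Qed.

Lemma CkrM k U f g : open U -> Ckr k U f -> Ckr k U g -> Ckr k U (fun x => f x * g x).
Proof.
move=> oU; elim: k f g => [|k IH] f g; first by move=> cf cg x Ux;
  exact: continuousM (cf x Ux) (cg x Ux).
move=> Cf Cg; have [Cf' Cg'] := (CkrW Cf, CkrW Cg).
move: Cf Cg => [df Df] [dg Dg]; split=> [x Ux|v].
  by apply: differentiableM; [exact: df|exact: dg].
apply: (@Ckr_ext _ _ (fun x => f x * 'D_v g x + g x * 'D_v f x)) => // [x Ux|].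
  by rewrite [RHS]deriveM //; apply: diff_derivable; [exact: df|exact: dg].
by apply: CkrD => //; [exact: IH Cf' (Dg v)|exact: IH Cg' (Df v)].
Qed.

(** The derivative of the inverse involves the inverse itself, whose regularity at the previous
    order is the induction hypothesis. *)
Lemma CkrV k U f : open U -> (forall x, U x -> f x != 0) ->
  Ckr k U f -> Ckr k U (fun x => (f x)^-1).
Proof.
move=> oU f0; elim: k => [|k IH]; first by move=> cf x Ux;
  exact: continuousV (f0 x Ux) (cf x Ux).
move=> Cf; have Vf := IH (CkrW Cf); case: Cf => [df Df]; split=> [x Ux|v].
  by apply: differentiableV; [exact: df|exact: f0].
apply: (@Ckr_ext _ _ (fun x => (-1) * ((f x)^-1 * (f x)^-1) * 'D_v f x)) => // [x Ux|].
  rewrite [RHS]deriveV; [|exact: f0|exact/diff_derivable/df].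
  by rewrite scaleNr mulN1r mulNr -expr2 exprVn.
apply: CkrM (Df v) => //; apply: CkrM (CkrM oU Vf Vf) => //; exact: Ckr_cst.
Qed.

Lemma Ckr_sum k U (I : Type) (r : seq I) (P : pred I) (F : I -> 'rV[R]_n -> R) :
  open U -> (forall i, P i -> Ckr k U (F i)) -> Ckr k U (fun x => \sum_(i <- r | P i) F i x).
Proof.
move=> oU CF; elim: r => [|i r IH].
  by apply: (Ckr_ext oU) (Ckr_cst _ _ 0) => x _; rewrite big_nil.
case Pi: (P i).
  apply: (Ckr_ext oU) (CkrD oU (CF i Pi) IH) => x _; by rewrite big_cons Pi.
by apply: (Ckr_ext oU) IH => x _; rewrite big_cons Pi.
Qed.

Lemma Ckr_prod k U (I : Type) (r : seq I) (F : I -> 'rV[R]_n -> R) :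
  open U -> (forall i, Ckr k U (F i)) -> Ckr k U (fun x => \prod_(i <- r) F i x).
Proof.
move=> oU CF; elim: r => [|i r IH].
  by apply: (Ckr_ext oU) (Ckr_cst _ _ 1) => x _; rewrite big_nil.
by apply: (Ckr_ext oU) (CkrM oU (CF i) IH) => x _; rewrite big_cons.
Qed.

Lemma Ckr_expz k U f (z : int) : open U -> (forall x, U x -> f x != 0) ->
  Ckr k U f -> Ckr k U (fun x => f x ^ z).
Proof.
move=> oU f0 Cf.
have Cn (m : nat) : Ckr k U (fun x => f x ^+ m).
  elim: m => [|m IH]; first by apply: (Ckr_ext oU) (Ckr_cst _ _ 1) => x _; rewrite expr0.
  by apply: (Ckr_ext oU) (CkrM oU Cf IH) => x _; rewrite exprS.
case: z => m; first exact: Cn.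
apply: (@Ckr_ext _ _ (fun x => (f x ^+ m.+1)^-1)) => //.
apply: CkrV => // x Ux; rewrite expf_neq0 //; exact: f0.
Qed.

End SmoothScalar.

Section SmoothMap.
Context {R : realType}.

Lemma differentiable_rowP (n m : nat) (f : 'rV[R]_n -> 'rV[R]_m) x :
  differentiable f x <-> forall i, differentiable (fun y => f y ord0 i : R) x.
Proof.
split=> [df i|df].
  exact: (@differentiable_comp _ _ _ _ f (fun z : 'rV[R]_m => z ord0 i : R) x df
    (differentiable_coord _ _ _)).
pose F (i : 'I_m) (y : 'rV[R]_n) : 'rV[R]_m := f y ord0 i *: delta_mx ord0 i.
have -> : f = \sum_(i < m) F i.
  by apply/funext => y; rewrite fct_sumE [LHS]row_sum_delta.
by apply: differentiable_sum => i; apply: differentiableZl.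
Qed.

Lemma continuous_rowP (T : topologicalType) (m : nat) (f : T -> 'rV[R]_m) x :
  {for x, continuous f} <-> forall i, {for x, continuous (fun y => f y ord0 i : R)}.
Proof.
split=> [cf i|cf]; first exact: (continuous_comp cf (@coord_continuous _ _ _ _ _ _)).
apply/cvg_ballP => e e0.
have : \forall t \near x, forall i : 'I_m, ball (f x ord0 i) e (f t ord0 i).
  by apply: filter_forall => i; have /cvg_ballP/(_ e e0) := cf i.
by apply: filterS => t fe; split=> // i j; rewrite (ord1 i); exact: fe.
Qed.

Lemma CkP (n m k : nat) (U : set 'rV[R]_n) (f : 'rV[R]_n -> 'rV[R]_m) : open U ->
  Ck k U f <-> forall i, Ckr k U (fun x => f x ord0 i).
Proof.
move=> oU; elim: k f => [|k IH] f /=.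
  split=> [cf i x /cf/continuous_rowP//|cf x Ux]; by apply/continuous_rowP => i; exact: cf.
have DE v x i : differentiable f x -> 'D_v f x ord0 i = 'D_v (fun y => f y ord0 i) x.
  by move=> df; rewrite derive_mx ?mxE //; exact: diff_derivable.
split=> [[df Df] i|df].
  split=> [x /df/differentiable_rowP//|v].
  by apply: (@Ckr_ext _ _ _ _ (fun x => 'D_v f x ord0 i)) => // [x /df|];
    [exact: DE|exact: (IH _).1 (Df v) i].
have df' x : U x -> differentiable f x.
  by move=> Ux; apply/differentiable_rowP => i; exact: (df i).1.
split=> // v; apply/IH => i.
apply: (@Ckr_ext _ _ _ _ ('D_v (fun x => f x ord0 i))) => // [x /df'|]; last exact: (df i).2.
by move/DE => ->.
Qed.

Lemma Ck_sub (n m k : nat) (U V : set 'rV[R]_n) (f : 'rV[R]_n -> 'rV[R]_m) :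
  open U -> open V -> V `<=` U -> Ck k U f -> Ck k V f.
Proof. by move=> oU oV VU /CkP Cf; apply/CkP => // i; apply: Ckr_sub VU _; apply: Cf. Qed.

Lemma derive_comp_row (n m : nat) (g : 'rV[R]_n -> 'rV[R]_m) (f : 'rV[R]_m -> R) v x :
  differentiable g x -> differentiable f (g x) ->
  'D_v (fun y => f (g y)) x =
  \sum_(i < m) 'D_v (fun y => g y ord0 i) x * 'D_(delta_mx ord0 i) f (g x).
Proof.
move=> dg df; rewrite deriveE; last exact: (differentiable_comp dg df).
rewrite (diff_comp dg df) /= -(deriveE v dg) derive_mx; last exact: diff_derivable.
rewrite [X in 'd f _ X]row_sum_delta linear_sum; apply: eq_bigr => i _.
by rewrite linearZ /= !mxE -(deriveE _ df).
Qed.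

(** By the chain rule, a directional derivative of the composite is a sum of products of derivatives
    of [g] with partial derivatives of [f] composed with [g]; the induction on [k] keeps [g] and
    varies [f]. *)
Lemma Ckr_comp (n m k : nat) (U : set 'rV[R]_n) (V : set 'rV[R]_m)
    (g : 'rV[R]_n -> 'rV[R]_m) (f : 'rV[R]_m -> R) :
  open U -> (forall x, U x -> V (g x)) ->
  Ck k U g -> Ckr k V f -> Ckr k U (f \o g).
Proof.
move=> oU UV; elim: k f => [|k IH] f Cg Cf.
  by move=> x Ux; apply: continuous_comp; [exact: Cg|exact/Cf/UV].
have Cgk : Ck k U g by apply/CkP => // i; apply: CkrW; move/CkP: Cg; apply.
have Cgi := (CkP k.+1 g oU).1 Cg.
case: Cg => [dg _]; case: Cf => [df Df].
split=> [x Ux|v]; first by apply: differentiable_comp; [exact: dg|exact/df/UV].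
apply: (@Ckr_ext _ _ _ _ (fun x => \sum_(i < m) 'D_v (fun y => g y ord0 i) x *
   'D_(delta_mx ord0 i) f (g x))) => // [x Ux|].
  by rewrite -derive_comp_row //; [exact: dg|exact/df/UV].
apply: Ckr_sum => // i _; apply: CkrM => //; first exact: (Cgi i).2.
exact: IH _ Cgk (Df _).
Qed.

Lemma Ck_comp (n m p k : nat) (U : set 'rV[R]_n) (V : set 'rV[R]_m)
    (g : 'rV[R]_n -> 'rV[R]_m) (f : 'rV[R]_m -> 'rV[R]_p) :
  open U -> open V -> (forall x, U x -> V (g x)) ->
  Ck k U g -> Ck k V f -> Ck k U (f \o g).
Proof.
move=> oU oV UV Cg /CkP Cf; apply/CkP => // i.
by apply: (Ckr_comp oU UV Cg (f := fun y => f y ord0 i)); apply: Cf.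
Qed.

Lemma Cinfty_differentiable (n m : nat) (U : set 'rV[R]_n) (f : 'rV[R]_n -> 'rV[R]_m) x :
  Cinfty U f -> U x -> differentiable f x.
Proof. by move=> /(_ 1%N)[df _]; exact: df. Qed.

Lemma jacobian_comp (n m p : nat) (g : 'rV[R]_n -> 'rV[R]_m) (f : 'rV[R]_m -> 'rV[R]_p) x :
  differentiable g x -> differentiable f (g x) ->
  jacobian (f \o g) x = jacobian g x *m jacobian f (g x).
Proof.
move=> dg df; apply/row_matrixP => i; rewrite !rowE -deriveEjacobian;
  last exact: differentiable_comp.
rewrite mulmxA -deriveEjacobian // deriveE; last exact: differentiable_comp.
by rewrite diff_comp //= -!deriveE // -deriveEjacobian.
Qed.

Lemma jacobianE (n m : nat) (f : 'rV[R]_n -> 'rV[R]_m) x i j : differentiable f x ->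
  jacobian f x i j = 'D_(delta_mx ord0 i) (fun y => f y ord0 j) x.
Proof.
move=> df; have := deriveEjacobian (delta_mx ord0 i) df.
rewrite -rowE => /rowP/(_ j); rewrite mxE => <-.
by rewrite derive_mx ?mxE //; exact: diff_derivable.
Qed.

(** The determinant is a polynomial in the first partial derivatives. Its continuity is what makes
    orientation signs locally constant. *)
Lemma det_jacobian_continuous (n : nat) (U : set 'rV[R]_n) (f : 'rV[R]_n -> 'rV[R]_n) x :
  open U -> Cinfty U f -> U x -> {for x, continuous (fun y => \det (jacobian f y))}.
Proof.
move=> oU Cf Ux.
have C1 := (CkP 1%N f oU).1 (Cf 1%N).
pose J y := \det (\matrix_(i, j) 'D_(delta_mx ord0 i) (fun z => f z ord0 j) y : 'M[R]_n).
suff : Ckr 0 U (fun y => \det (jacobian f y)) by apply.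
apply: (@Ckr_ext _ _ _ _ J) => // [y Uy|].
  congr (\det _); apply/matrixP => i j; rewrite mxE jacobianE //.
  exact: Cinfty_differentiable Uy.
rewrite /J; apply: Ckr_sum => // s _; apply: CkrM => //; first exact: Ckr_cst.
apply: Ckr_prod => // i.
apply: (@Ckr_ext _ _ 0 U ('D_(delta_mx ord0 i) (fun z => f z ord0 (s i)))) => // [y _|].
  by rewrite mxE.
by case: (C1 (s i)) => _; apply.
Qed.

End SmoothMap.

Section JacobianFacts.
Context {R : realType}.

Lemma jacobian_near_eq (n m : nat) (f g : 'rV[R]_n -> 'rV[R]_m) x :
  (\near x, f x = g x) -> differentiable f x -> jacobian f x = jacobian g x.
Proof.
move=> fg df; have dg := differentiable_near_eq fg df.
apply/matrixP => i j; apply: etrans (jacobianE i j df) (etrans _ (esym (jacobianE i j dg))).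
by apply: near_eq_derive; apply: filterS fg => y ->.
Qed.

Lemma Cinfty_mulmxr (n m : nat) (M : 'M[R]_(n, m)) (U : set 'rV[R]_n) :
  open U -> Cinfty U (fun y => y *m M).
Proof.
move=> oU k; apply/CkP => // i.
have : Ckr k U (fun y => \sum_(j < n) y ord0 j * M j i).
  by apply: Ckr_sum => // j _; apply: CkrM => //; [exact: Ckr_coord|exact: Ckr_cst].
by apply: Ckr_ext => // y _; rewrite mxE.
Qed.

Lemma jacobian_mulmxr (n m : nat) (M : 'M[R]_(n, m)) x :
  differentiable (fun y : 'rV[R]_n => y *m M) x /\ jacobian (fun y => y *m M) x = M.
Proof.
have dM : differentiable (fun y : 'rV[R]_n => y *m M) x.
  exact: (Cinfty_differentiable (Cinfty_mulmxr M openT)).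
split=> //; apply/row_matrixP => i; rewrite !rowE -(deriveEjacobian _ dM).
apply: cvg_lim; first exact: norm_hausdorff.
apply: cvg_near_cst; near=> h.
have h0 : h != 0 by near: h; exact: nbhs_dnbhs_neq.
by rewrite /= mulmxDl addrK -scalemxAl scalerA mulVf ?scale1r.
Unshelve. all: by end_near. Qed.

Lemma open_setI_preimage (S T : topologicalType) (U : set S) (V : set T) (g : S -> T) :
  open U -> open V -> (forall x, U x -> {for x, continuous g}) -> open (U `&` g @^-1` V).
Proof.
move=> oU oV cg; rewrite openE => x [Ux Vx].
by apply: filterI; [exact: open_nbhs_nbhs|apply: (cg x Ux); exact: open_nbhs_nbhs].
Qed.

Lemma Cinfty_comp (n m p : nat) (U : set 'rV[R]_n) (V : set 'rV[R]_m)
    (g : 'rV[R]_n -> 'rV[R]_m) (f : 'rV[R]_m -> 'rV[R]_p) :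
  open U -> open V -> (forall x, U x -> V (g x)) ->
  Cinfty U g -> Cinfty V f -> Cinfty U (f \o g).
Proof. by move=> oU oV UV Cg Cf k; apply: Ck_comp (Cg k) (Cf k). Qed.

Lemma Cinfty_sub (n m : nat) (U V : set 'rV[R]_n) (f : 'rV[R]_n -> 'rV[R]_m) :
  open U -> open V -> V `<=` U -> Cinfty U f -> Cinfty V f.
Proof. by move=> oU oV VU Cf k; apply: Ck_sub VU (Cf k). Qed.

Lemma Cinfty_continuous (n m : nat) (U : set 'rV[R]_n) (f : 'rV[R]_n -> 'rV[R]_m) x :
  Cinfty U f -> U x -> {for x, continuous f}.
Proof. by move=> Cf Ux; apply: (Cf 0). Qed.

End JacobianFacts.

(** * Transition maps between charts *)

Lemma mul1_neq0l (R : nzRingType) (x y : R) : x * y = 1 -> x != 0.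
Proof. by move=> xy; apply/eqP => x0; move/eqP: xy; rewrite x0 mul0r eq_sym oner_eq0. Qed.

Lemma signed_det_mul (R : realDomainType) (n : nat) (A B C : 'M[R]_n) (e1 e2 : R) :
  A = B *m C -> 0 < e1 * \det B -> 0 < e2 * \det C -> 0 < e1 * e2 * \det A.
Proof. by move=> -> d1 d2; rewrite det_mulmx mulrACA mulr_gt0. Qed.

Lemma signed_det_uniq (R : realDomainType) (n : nat) (A B : 'M[R]_n) (e1 e2 : R) :
  A = B -> 0 < e1 * \det A -> 0 < e2 * \det B -> 0 < e1 * e2.
Proof.
move=> ->; set d := \det B => d1 d2.
have : 0 < (e1 * d) * (e2 * d) by rewrite mulr_gt0.
rewrite mulrACA pmulr_lgt0 // -expr2 lt_def sqr_ge0 andbT sqrf_eq0.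
by apply/eqP => d0; rewrite d0 mulr0 ltxx in d1.
Qed.

Section LocalExpr.
Context {R : realType} {T : Type}.

(** [O] confines [D3] to points of both [D1] and [D2]: a point where [a] and [c] are meaningful may
    lie outside the domain of the intermediate coordinates [b]. *)
Lemma local_expr_comp (n m k : nat) (D1 D2 D3 : set T) (a : T -> 'rV[R]_n)
    (b : T -> 'rV[R]_m) (c : T -> 'rV[R]_k) p U g V h O :
  local_expr D1 a b p U g -> local_expr D2 b c p V h -> D1 p ->
  open O -> O (a p) -> (forall q, D3 q -> O (a q) -> D1 q /\ D2 q) ->
  local_expr D3 a c p (U `&` g @^-1` V `&` O) (h \o g).
Proof.
move=> [oU Up Cg gE] [oV Vp Ch hE] Dp oO Op D12.
have oW : open (U `&` g @^-1` V).
  by apply: open_setI_preimage => // x Ux; exact: Cinfty_continuous Ux.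
have oWO := openI oW oO.
split=> //.
- by split=> //; split=> //; rewrite /preimage /= gE.
- apply: (@Cinfty_comp _ _ _ _ _ V) => // [x [[]]//|].
  by apply: Cinfty_sub Cg => // x [[]].
- move=> q Dq [[Uq Vq] Oq]; have [D1q D2q] := D12 q Dq Oq.
  by rewrite /= gE // hE // -gE.
Qed.

(** A local expression is pinned down only on the image of [a]; where this image fills a
    neighbourhood of [a p], two expressions agree as germs. *)
Lemma local_expr_jacobian_uniq (n m : nat) (D D' : set T) (a : T -> 'rV[R]_n)
    (b : T -> 'rV[R]_m) p U g V h :
  local_expr D a b p U g -> local_expr D' a b p V h -> nbhs (a p) (a @` (D `&` D')) ->
  jacobian g (a p) = jacobian h (a p).
Proof.
move=> [oU Up Cg gE] [oV Vp Ch hE] Na; apply: jacobian_near_eq;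
  last exact: Cinfty_differentiable Up.
have NU : nbhs (a p) U by exact: open_nbhs_nbhs.
have NV : nbhs (a p) V by exact: open_nbhs_nbhs.
apply: filterS (filterI Na (filterI NU NV)) => x [[q [Dq D'q] <-] [Uq Vq]].
by rewrite gE // hE.
Qed.

(** Only the sign of [e] matters. Besides 1 and -1, a Jacobian determinant itself will serve as [e],
    which avoids a case distinction on its sign. *)
Definition signed_at (n : nat) (e : R) (D : set T) (a b : T -> 'rV[R]_n) (p : T) : Prop :=
  exists U g, local_expr D a b p U g /\ 0 < e * \det (jacobian g (a p)).

Lemma positive_atE (n : nat) (D : set T) (a b : T -> 'rV[R]_n) p :
  positive_at D a b p <-> signed_at 1 D a b p.
Proof. by split=> -[U [g [E d]]]; exists U, g; split=> //; move: d; rewrite mul1r. Qed.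

(** Composing with a local expression of the inverse expresses [a] in terms of itself; by uniqueness
    the Jacobian of the composite is the identity, and the chain rule makes the determinant
    invertible. *)
Lemma local_expr_inv_det_neq0 (n : nat) (D : set T) (a b : T -> 'rV[R]_n) p U g :
  D p -> nbhs (a p) (a @` D) -> local_expr D a b p U g -> smooth_at D b a p ->
  \det (jacobian g (a p)) != 0.
Proof.
move=> Dp Na E1 [V [h E2]].
have E3 := @local_expr_comp n n n D D D a b a p U g V h setT E1 E2 Dp openT I (fun q Dq _
  => conj Dq Dq).
case: (E1) => oU Up Cg gE; case: (E2) => oV Vp Ch hE.
have E4 : local_expr D a a p setT (fun y => y *m 1%:M).
  split=> //; first exact: openT.
    by apply: Cinfty_mulmxr; exact: openT.
  by move=> q _ _; rewrite mulmx1.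
have := local_expr_jacobian_uniq E3 E4; rewrite setIid => /(_ Na).
rewrite (jacobian_mulmxr _ _).2 jacobian_comp; last 2 first.
- exact: Cinfty_differentiable Up.
- by rewrite gE //; exact: Cinfty_differentiable Vp.
move=> /(congr1 determinant); rewrite det_mulmx det1 => E.
exact: mul1_neq0l E.
Qed.

Lemma signed_at_comp (n : nat) e1 e2 (D1 D2 D3 : set T) (a b c : T -> 'rV[R]_n) p O :
  signed_at e1 D1 a b p -> signed_at e2 D2 b c p -> D1 p ->
  open O -> O (a p) -> (forall q, D3 q -> O (a q) -> D1 q /\ D2 q) ->
  signed_at (e1 * e2) D3 a c p.
Proof.
move=> [U [g [E1 d1]]] [V [h [E2 d2]]] D1p oO Op D12.
have E := local_expr_comp E1 E2 D1p oO Op D12.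
case: (E1) => oU Up Cg gE; case: (E2) => oV Vp Ch hE.
exists (U `&` g @^-1` V `&` O), (h \o g); split; first exact: E.
have dg := Cinfty_differentiable Cg Up.
have gb := gE p D1p Up; rewrite -gb in d2 Vp.
have dh := Cinfty_differentiable Ch Vp.
exact: signed_det_mul (jacobian_comp dg dh) d1 d2.
Qed.

Lemma signed_at_uniq (n : nat) e1 e2 (D1 D2 : set T) (a b : T -> 'rV[R]_n) p :
  signed_at e1 D1 a b p -> signed_at e2 D2 a b p -> nbhs (a p) (a @` (D1 `&` D2)) ->
  0 < e1 * e2.
Proof.
move=> [U [g [E1 d1]]] [V [h [E2 d2]]] Na.
exact: signed_det_uniq (local_expr_jacobian_uniq E1 E2 Na) d1 d2.
Qed.

Lemma signed_at_near (n : nat) e (D : set T) (a b : T -> 'rV[R]_n) p :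
  signed_at e D a b p -> D p ->
  exists O, [/\ open O, O (a p) & forall q, O (a q) -> signed_at e D a b q].
Proof.
move=> [U [g [[oU Up Cg gE] d]]] Dp.
have cd : forall x, U x -> {for x, continuous (fun y => e * \det (jacobian g y))}.
  by move=> x Ux; apply: continuousM;
    [exact: cst_continuous|exact: det_jacobian_continuous Ux].
exists (U `&` (fun y => e * \det (jacobian g y)) @^-1` [set x | 0 < x]); split.
- by apply: open_setI_preimage => //; exact: open_gt.
- by split.
- by move=> q [Uq dq]; exists U, g; split.
Qed.

End LocalExpr.

Lemma neq0_sign_or (R : realDomainType) (x : R) : x != 0 -> 0 < 1 * x \/ 0 < (-1) * x.
Proof. by rewrite mul1r mulN1r oppr_gt0 neq_lt => /orP[]; [right|left]. Qed.

Lemma sqr_gt0 (R : realDomainType) (x : R) : x != 0 -> 0 < x * x.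
Proof. by move=> x0; rewrite -expr2 lt_def sqr_ge0 sqrf_eq0 x0. Qed.

(** * The sign of a chart relative to an orientation *)

Section OrientedAtlas.
Context {R : realType} {T : topologicalType} {n : nat}.
Implicit Types (c b : chart R T n) (A : set (chart R T n)).

Lemma chart_image_nbhs c (D : set T) p :
  is_chart [set: 'rV[R]_n] c -> open D -> D `<=` cdom c -> D p -> nbhs (c p) (c @` D).
Proof.
move=> [_ _ _ img] oD Dc Dp; have [V oV E] := img D oD Dc.
rewrite E setIT; apply: open_nbhs_nbhs; split=> //.
by have : (c @` D) (c p) by [exists p]; rewrite E => -[].
Qed.

Lemma signed_at_chart_comp e1 e2 c b b' p :
  is_chart setT c -> is_chart setT b -> is_chart setT b' ->
  cdom c p -> cdom b p -> cdom b' p ->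
  signed_at e1 (cdom c `&` cdom b) c b p ->
  signed_at e2 (cdom b `&` cdom b') b b' p ->
  signed_at (e1 * e2) (cdom c `&` cdom b') c b' p.
Proof.
move=> hc hb hb' cp bp b'p s1 s2.
have [oc injc _ img] := hc; have [ob _ _ _] := hb; have [ob' _ _ _] := hb'.
have oD : open (cdom c `&` (cdom b `&` cdom b')) by do 2?apply: openI.
(* [V] cuts out the image under [c] of the triple overlap; by injectivity of [c], a point sent into
   it also lies in the domain of [b]. *)
have [V oV E] := img _ oD (@subIsetl _ _ _).
have Vp : V (c p) by have : (c @` (cdom c `&` (cdom b `&` cdom b'))) (c p) by [exists p];
  rewrite E => -[].
apply: (@signed_at_comp _ _ _ _ _ _ _ _ _ _ _ _ V s1 s2) => // q [cq b'q] Vq.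
have : (c @` (cdom c `&` (cdom b `&` cdom b'))) (c q) by rewrite E.
by move=> [q' [cq' [bq' b'q']] /injc]; rewrite !inE => /(_ cq' cq) <-.
Qed.

Lemma signed_at_chart_uniq e1 e2 c b p :
  is_chart setT c -> is_chart setT b -> cdom c p -> cdom b p ->
  signed_at e1 (cdom c `&` cdom b) c b p ->
  signed_at e2 (cdom c `&` cdom b) c b p -> 0 < e1 * e2.
Proof.
move=> hc hb cp bp s1 s2; apply: (signed_at_uniq s1 s2).
have [oc _ _ _] := hc; have [ob _ _ _] := hb; rewrite setIid.
by apply: chart_image_nbhs => //; exact: openI.
Qed.

Section Sign.
Variables (A : set (chart R T n)) (b : chart R T n).
Hypothesis hA : oriented_atlas [set: 'rV[R]_n] A.
Hypothesis hb : is_chart [set: 'rV[R]_n] b.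
Hypothesis smcb : forall c p, A c -> (cdom c `&` cdom b) p ->
  smooth_at (cdom c `&` cdom b) c b p.
Hypothesis smbc : forall c p, A c -> (cdom c `&` cdom b) p ->
  smooth_at (cdom c `&` cdom b) b c p.

(** Quantifying over all charts of [A] makes the sign independent of a choice; by [has_sign_exists]
    a single chart decides it. *)
Definition has_sign e p := forall c, A c -> cdom c p -> signed_at e (cdom c `&` cdom b) c b p.

Lemma has_sign_exists e p c : A c -> cdom c p -> cdom b p ->
  signed_at e (cdom c `&` cdom b) c b p -> has_sign e p.
Proof.
case: hA => chA _ posA Ac cp bp s c' Ac' c'p.
have s' : signed_at 1 (cdom c' `&` cdom c) c' c p by apply/positive_atE/posA.
rewrite -[e]mul1r.
by apply: (signed_at_chart_comp _ _ _ _ _ _ s' s) => //; exact: chA.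
Qed.

Lemma has_sign_dec p : cdom b p -> has_sign 1 p \/ has_sign (-1) p.
Proof.
case: hA => chA covA posA bp.
have [c Ac cp] := covA p.
have [U [g E]] := smcb Ac (conj cp bp).
have d0 : \det (jacobian g (c p)) != 0.
  apply: (local_expr_inv_det_neq0 _ _ E) => //; last exact: smbc.
  apply: chart_image_nbhs => //; [exact: chA|].
  by have [oc _ _ _] := chA c Ac; have [ob _ _ _] := hb; exact: openI.
have [d|d] : 0 < 1 * \det (jacobian g (c p)) \/ 0 < (-1) * \det (jacobian g (c p)).
- exact: neq0_sign_or.
- by left; apply: (has_sign_exists Ac) => //; exists U, g.
- by right; apply: (has_sign_exists Ac) => //; exists U, g.
Qed.

Lemma has_sign_excl e p : e != 0 -> cdom b p -> has_sign e p -> has_sign (- e) p -> False.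
Proof.
case: hA => chA covA posA e0 bp s s'.
have [c Ac cp] := covA p.
have := signed_at_chart_uniq (chA c Ac) hb cp bp (s c Ac cp) (s' c Ac cp).
by rewrite mulrN oppr_gt0 -expr2 ltNge sqr_ge0.
Qed.

Lemma has_sign_near e p : cdom b p -> has_sign e p -> \forall q \near p, cdom b q ->
  has_sign e q.
Proof.
case: hA => chA covA posA bp s.
have [c Ac cp] := covA p.
have [oc _ cc _] := chA c Ac.
have [N [oN Np nearO]] := signed_at_near (s c Ac cp) (conj cp bp).
have N1 : nbhs p (cdom c) by exact: open_nbhs_nbhs.
have N2 : nbhs p (c @^-1` N) by apply: (cc p cp); exact: open_nbhs_nbhs.
apply: filterS (filterI N1 N2) => q [cq Oq] bq.
by apply: (has_sign_exists Ac) => //; exact: nearO.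
Qed.

(** The line through 0 and [x] joins [alpha 0] to [alpha x]. Along it, having sign [e] and having
    sign [- e] are open conditions, exclusive and exhaustive, so connectedness of the line spreads
    the sign at 0. *)
Lemma has_sign_const (alpha : 'rV[R]_n -> T) : continuous alpha -> range alpha = cdom b ->
  exists2 e, (e = 1 \/ e = -1) & forall p, cdom b p -> has_sign e p.
Proof.
move=> ca ra.
have ba x : cdom b (alpha x) by rewrite -ra; exists x.
have dec x : has_sign 1 (alpha x) \/ has_sign (-1) (alpha x) by exact: has_sign_dec.
suff spread e : (e = 1 \/ e = -1) -> has_sign e (alpha 0) -> forall x, has_sign e (alpha x).
  by case: (dec 0) => [s|s]; [exists 1|exists (-1)]; rewrite -?ra; auto;
     move=> p [x _ <-]; apply: spread => //; auto.
move=> e1 s0 x.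
have e0 : e != 0 by case: e1 => ->; rewrite ?oppr_eq0 oner_eq0.
have dec' y : has_sign e (alpha y) \/ has_sign (- e) (alpha y).
  by have := dec y; case: e1 => ->; rewrite ?opprK; tauto.
have cl : continuous (fun t : R => alpha (t *: x)).
  by move=> t; apply: continuous_comp; [exact: scalel_continuous|exact: ca].
have opn e' : open [set t : R | has_sign e' (alpha (t *: x))].
  rewrite openE => t /= st.
  have N : nbhs t [set r : R | cdom b (alpha (r *: x)) -> has_sign e' (alpha (r *: x))].
    exact: cl t _ (has_sign_near (ba (t *: x)) st).
  by apply: filterS N => r H; exact: H (ba _).
have conn : connected [set: R] by apply/connected_intervalP => ? ? ? ? ? ?.
have E : [set t : R | has_sign e (alpha (t *: x))] = setT.
  apply: conn; first by exists 0; rewrite /= scale0r.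
    by exists [set t : R | has_sign e (alpha (t *: x))]; rewrite ?setTI //; exact: opn.
  exists (~` [set t : R | has_sign (- e) (alpha (t *: x))]); first exact: open_closedC.
  rewrite setTI; apply/seteqP; split=> t /= s; first exact: has_sign_excl.
  by case: (dec' (t *: x)).
have : [set t : R | has_sign e (alpha (t *: x))] 1 by rewrite E.
by rewrite /= scale1r.
Qed.

End Sign.

Lemma has_sign_transition A b b' e e' p U phi :
  oriented_atlas [set: 'rV[R]_n] A ->
  is_chart setT b -> is_chart setT b' ->
  cdom b p -> cdom b' p ->
  has_sign A b e p -> has_sign A b' e' p ->
  local_expr (cdom b `&` cdom b') b b' p U phi ->
  smooth_at (cdom b `&` cdom b') b' b p ->
  0 < e * e' * \det (jacobian phi (b p)).
Proof.
move=> [chA covA posA] hb hb' bp b'p s s' E sm.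
have [c Ac cp] := covA p.
have [ob _ _ _] := hb; have [ob' _ _ _] := hb'.
have d0 : \det (jacobian phi (b p)) != 0.
  apply: (local_expr_inv_det_neq0 _ _ E sm) => //.
  by apply: chart_image_nbhs => //; exact: openI.
(* With the determinant itself as sign, positivity is that of a non-zero square. Composing with [e]
   and comparing with [e'] by uniqueness of signs gives the claim. *)
have sd : signed_at (\det (jacobian phi (b p))) (cdom b `&` cdom b') b b' p.
  by exists U, phi; split; [exact: E|exact: sqr_gt0].
have := signed_at_chart_comp (chA c Ac) hb hb' cp bp b'p (s c Ac cp) sd.
move/(signed_at_chart_uniq (chA c Ac) hb' cp b'p) => /(_ _ (s' c Ac cp)).
by rewrite mulrAC.
Qed.

End OrientedAtlas.

(** * The disc bundle *)

Section Exponents.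
Context {n : nat} (a : 'M[int]_n).
Implicit Types s t : @bott_cone n.

Lemma cone_gens_lower s (k i : 'I_n) : (i < k)%N -> cone_gens a s k i = 0.
Proof.
move=> ik; have ki : (i == k) = false by apply/negbTE; rewrite -val_eqE /= neq_ltn ik.
rewrite mxE /bott_ray; case: (s k); rewrite !mxE ?ki ?andbF // oppr0 add0r summxE.
apply: big1 => l kl; rewrite !mxE.
have /negPf-> : i != l by rewrite -val_eqE /= neq_ltn (ltn_trans ik kl).
by rewrite andbF mulr0.
Qed.

Lemma cone_gens_diag s k : cone_gens a s k k = if s k then -1 else 1.
Proof.
rewrite mxE /bott_ray; case: (s k); rewrite !mxE !eqxx // summxE big1 ?addr0 // => l kl.
rewrite !mxE; have /negPf-> : k != l by rewrite -val_eqE /= neq_ltn kl.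
by rewrite andbF mulr0.
Qed.

Lemma exponents_gens s t : exponents a s t *m cone_gens a t = cone_gens a s.
Proof. by rewrite /exponents mulmxKV ?cone_gens_unit. Qed.

Lemma cone_gens_diag_sqr s k : cone_gens a s k k * cone_gens a s k k = 1.
Proof. by rewrite cone_gens_diag; case: (s k). Qed.

(** In the entry (k, i) of [exponents_gens], triangularity of the generators and induction on [i]
    leave a single term, whose diagonal factor is a unit. Thus a new coordinate [i] involves only
    the old coordinates up to [i]: this is the tower of bundles. *)
Lemma exponents_lower s t (k i : 'I_n) : (i < k)%N -> exponents a s t k i = 0.
Proof.
have [m] := ubnP (i : nat); elim: m i => // m IH i; rewrite ltnS => im ik.
have := congr1 (fun M : 'M[int]_n => M k i) (exponents_gens s t).
rewrite cone_gens_lower // mxE (bigD1 i) //= big1 => [|l li]; last first.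
  have [il|il] := ltnP i l; first by rewrite cone_gens_lower ?mulr0.
  have {}li : (l < i)%N by rewrite ltn_neqAle li.
  by rewrite IH ?mul0r ?(leq_trans li im) ?(ltn_trans li ik).
rewrite addr0 => /(congr1 ( *%R^~ (cone_gens a t i i))).
by rewrite -mulrA cone_gens_diag_sqr mulr1 mul0r.
Qed.

Lemma exponents_diag s t k : exponents a s t k k = if s k == t k then 1 else -1.
Proof.
have := congr1 (fun M : 'M[int]_n => M k k) (exponents_gens s t).
rewrite mxE (bigD1 k) //= big1 => [|l lk]; last first.
  have [kl|kl] := ltnP k l; first by rewrite cone_gens_lower ?mulr0.
  by rewrite exponents_lower ?mul0r // ltn_neqAle lk.
rewrite addr0 => /(congr1 ( *%R^~ (cone_gens a t k k))).
rewrite -mulrA cone_gens_diag_sqr mulr1 => ->.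
by rewrite !cone_gens_diag; case: (s k); case: (t k).
Qed.

Definition flip_at s (j : 'I_n) : @bott_cone n := [ffun i => if i == j then ~~ s i else s i].

Lemma flip_atE s j i : (s i != flip_at s j i) = (i == j).
Proof. by rewrite ffunE; case: (i == j); case: (s i). Qed.

Lemma coord_change_flip (F : fieldType) s j (x : 'rV[F]_n) i :
  coord_change a s (flip_at s j) x ord0 i =
  if i == j then (x ord0 j)^-1 else x ord0 i * x ord0 j ^ exponents a s (flip_at s j) j i.
Proof.
have sh k l : k != j -> exponents a s (flip_at s j) k l = (k == l)%:R.
  by move=> kj; apply: exponents_shared; apply/eqP; apply: contraNT kj; rewrite flip_atE.
rewrite mxE (bigD1 j) //=; have [->|ij] := eqVneq i j.
  rewrite exponents_diag -{1}[s j == _]negbK flip_atE eqxx /= big1 => [|k kj].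
    by rewrite mulr1 exprN1.
  by rewrite sh // (negPf kj) expr0z.
rewrite (bigD1 i) //= (sh i) // eqxx expr1z big1 => [|k /andP[kj ki]].
  by rewrite mulr1 mulrC.
by rewrite sh // (negPf ki) expr0z.
Qed.

Lemma coord_change_map (F F' : fieldType) (f : {rmorphism F -> F'}) s t (x : 'rV[F]_n) :
  coord_change a s t (map_mx f x) = map_mx f (coord_change a s t x).
Proof.
apply/rowP => i; rewrite !mxE rmorph_prod; apply: eq_bigr => j _.
by rewrite mxE fmorphXz.
Qed.

(** Monomials commute with field morphisms. The two instances of interest are the inclusion of [R]
    in [R[i]] and complex conjugation. *)
Lemma bott_glue_map (F F' : fieldType) (f : {rmorphism F -> F'}) s t (x y : 'rV[F]_n) :
  bott_glue a (existT (fun=> 'rV[F']_n) s (map_mx f x)) (existT _ t (map_mx f y)) =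
  bott_glue a (existT (fun=> 'rV[F]_n) s x) (existT _ t y).
Proof.
rewrite /bott_glue /= coord_change_map; congr (_ && _).
  by apply: eq_forallb => j; rewrite mxE fmorph_eq0.
by apply/eqP/eqP => [/map_mx_inj|->].
Qed.

End Exponents.

Section DiscBundle.
Variables (R : realType) (m : nat) (a : 'M[int]_m.+1).
Implicit Types (s t : @bott_cone m.+1) (y z : 'rV[R]_m.+2) (x : 'rV[R]_m.+1) (i j : 'I_m.+1).

(** [h] comes first because [half_space] and [boundary_chart] take the leading coordinate as normal
    to the boundary. *)
Definition hcons (h : R) x : 'rV[R]_m.+2 :=
  \row_k if unlift ord0 k is Some i then x ord0 i else h.

Definition base y : 'rV[R]_m.+1 := \row_i y ord0 (lift ord0 i).

Lemma hcons0 h x : hcons h x ord0 ord0 = h. Proof. by rewrite mxE unlift_none. Qed.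

Lemma hconsS h x i : hcons h x ord0 (lift ord0 i) = x ord0 i.
Proof. by rewrite mxE liftK. Qed.

Lemma base_hcons h x : base (hcons h x) = x.
Proof. by apply/rowP => i; rewrite mxE hconsS. Qed.

Lemma hcons_base y : hcons (y ord0 ord0) (base y) = y.
Proof.
by apply/rowP => k; rewrite mxE; case: unliftP => [i ->|->] //; rewrite mxE.
Qed.

(* [y ord0 ord0] is the imaginary part of the last coordinate. *)
Definition cplx y : 'rV[R[i]]_m.+1 :=
  \row_i Complex (y ord0 (lift ord0 i)) (if i == ord_max then y ord0 ord0 else 0).

Lemma cplx_inj : injective cplx.
Proof.
move=> y z /rowP yz; apply/rowP => k; case: (unliftP ord0 k) => [i ->|->].
  by have := yz i; rewrite !mxE => -[].
by have := yz ord_max; rewrite !mxE eqxx => -[].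
Qed.

Lemma cplx_hcons0 x : cplx (hcons 0 x) = map_mx (real_complex R) x.
Proof. by apply/rowP => i; rewrite mxE hconsS hcons0 if_same mxE. Qed.

Definition conjh y := hcons (- y ord0 ord0) (base y).

Lemma conjhK : involutive conjh.
Proof. by move=> y; rewrite /conjh hcons0 base_hcons opprK hcons_base. Qed.

Lemma cplx_conjh y : cplx (conjh y) = map_mx (@conjc R) (cplx y).
Proof.
apply/rowP => i; rewrite mxE /conjh hconsS hcons0 !mxE /=; case: ifP => //.
by rewrite oppr0.
Qed.

Definition glueC s (u : 'rV[R[i]]_m.+1) t (v : 'rV[R[i]]_m.+1) :=
  bott_glue a (existT (fun=> 'rV[R[i]]_m.+1) s u) (existT _ t v).

Lemma glueC_conj s y t z : glueC s (cplx (conjh y)) t (cplx (conjh z)) = glueC s (cplx y) t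
  (cplx z).
Proof. by rewrite !cplx_conjh; exact: bott_glue_map. Qed.

(* [y] and [conjh y] are two names of the same point of the quotient by
   conjugation; hence [cell] below is two-to-one off the boundary, and no
   half-space is needed to parametrize the quotient. *)
Definition disc_glue : rel {s : @bott_cone m.+1 & 'rV[R]_m.+2} := fun p q =>
  glueC (tag p) (cplx (tagged p)) (tag q) (cplx (tagged q)) ||
  glueC (tag p) (cplx (tagged p)) (tag q) (cplx (conjh (tagged q))).

Lemma disc_glue_refl : reflexive disc_glue.
Proof. by move=> p; rewrite /disc_glue [glueC _ _ _ _]bott_glue_refl. Qed.

Lemma glueC_sym s u t v : glueC s u t v = glueC t v s u.
Proof. exact: bott_glue_sym. Qed.

Lemma glueC_trans s u t v r w : glueC s u t v -> glueC t v r w -> glueC s u r w.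
Proof. exact: bott_glue_trans. Qed.

Lemma disc_glue_sym : symmetric disc_glue.
Proof.
move=> [s y] [t z]; rewrite /disc_glue /= glueC_sym; congr (_ || _).
by rewrite glueC_sym -glueC_conj conjhK.
Qed.

Lemma disc_glue_trans : transitive disc_glue.
Proof.
move=> [t z] [s y] [r w]; rewrite /disc_glue /= => /orP[yz|yz] /orP[zw|zw].
- by rewrite (glueC_trans yz zw).
- by rewrite (glueC_trans yz zw) orbT.
- by move: zw; rewrite -glueC_conj => /(glueC_trans yz) ->; rewrite orbT.
- by move: zw; rewrite -glueC_conj conjhK => /(glueC_trans yz) ->.
Qed.

Definition disc_glue_equiv :=
  EquivRel _ disc_glue_refl disc_glue_sym disc_glue_trans.

Definition disc_bundle_quot : Type := {eq_quot disc_glue_equiv}%qT.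
HB.instance Definition _ := Quotient.on disc_bundle_quot.
HB.instance Definition _ := Choice.on disc_bundle_quot.

Definition disc_bundle : Type := disc_bundle_quot.
HB.instance Definition _ := Quotient.on disc_bundle.
HB.instance Definition _ :=
  Topological.copy disc_bundle (quotient_topology disc_bundle).

Definition cell s y : disc_bundle :=
  (\pi_disc_bundle (existT (fun=> 'rV[R]_m.+2) s y))%qT.

Lemma cellP s y t z : reflect (cell s y = cell t z)
  (glueC s (cplx y) t (cplx z) || glueC s (cplx y) t (cplx (conjh z))).
Proof.
exact: (@eqmodP _ disc_glue_equiv (existT _ s y) (existT _ t z)).
Qed.

Lemma cell_surj (p : disc_bundle) : exists s y, p = cell s y.
Proof.
rewrite -[p]reprK; case: (repr p) => s y; by exists s, y.
Qed.

Lemma cell_inj s y z : cell s y = cell s z <-> z = y \/ z = conjh y.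
Proof.
split=> [/cellP|].
  case/orP => /andP[_ /eqP /=]; rewrite coord_changexx => /cplx_inj; first by left.
  by move=> <-; right; rewrite conjhK.
by move=> zy; apply/cellP; apply/orP; case: zy => ->; [left|right; rewrite conjhK];
  exact: bott_glue_refl.
Qed.

Lemma cell_conjh s y : cell s (conjh y) = cell s y.
Proof. by apply/esym/cell_inj; right. Qed.

Lemma cell_neq0 s y t z k : cell s y = cell t z -> s k != t k -> cplx y ord0 k != 0.
Proof.
move=> /cellP/orP[] /andP[/forallP /(_ k) /= /implyP h _]; exact: h.
Qed.

Lemma cell_neq0_shared s y t z k : cell s y = cell t z -> s k = t k ->
  (cplx z ord0 k != 0) = (cplx y ord0 k != 0).
Proof.
have main w : glueC s (cplx y) t (cplx w) -> s k = t k ->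
    (cplx w ord0 k != 0) = (cplx y ord0 k != 0).
  by move=> /bott_glueP/= [st ->]; exact: coord_change_neq0.
move=> /cellP/orP[/main//|/main h] /h <-.
by rewrite cplx_conjh [in RHS]mxE fmorph_eq0.
Qed.

(** At [h = 0] conjugation is trivial, so the two alternatives of [disc_glue] merge and complex
    gluing restricts to real gluing. The two directions make the inclusion of Y_n in W well defined
    and injective. *)
Lemma cell_real s x t x' : affine_chart a s x = affine_chart a t x' <->
  cell s (hcons 0 x) = cell t (hcons 0 x').
Proof.
have E : glueC s (cplx (hcons 0 x)) t (cplx (hcons 0 x')) =
   bott_glue a (existT (fun=> 'rV[R]_m.+1) s x) (existT _ t x').
  by rewrite /glueC !cplx_hcons0 bott_glue_map.
have conj0 : conjh (hcons 0 x') = hcons 0 x'.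
  by rewrite /conjh hcons0 base_hcons oppr0.
split=> [/(@eqmodP _ (bott_glue_equiv a R)) /= st|/cellP].
  by apply/cellP; rewrite E st.
by rewrite conj0 orbb E => st; apply/(@eqmodP _ (bott_glue_equiv a R)).
Qed.

Lemma mulc_real (u v c : R) : Complex u v * (real_complex R c) = Complex (u * c) (v * c) :>
  R[i].
Proof. by rewrite /real_complex_def; simpc;
  rewrite ?mulr0 ?subr0 ?addr0 ?add0r // [v * c]mulrC. Qed.

(* [e] is the sign of the coordinate [j].  Scaling [h] by the power of [e * x_j]
   rather than of [x_j] only amounts to a conjugation, and preserves the sign of
   [h]. *)
Definition flip_map (e : R) s j y :=
  hcons (y ord0 ord0 * (e * y ord0 (lift ord0 j)) ^ exponents a s (flip_at s j) j ord_max)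
    (coord_change a s (flip_at s j) (base y)).

Lemma sign_expz (e : R) (z : int) : e = 1 \/ e = -1 -> e ^ z = 1 \/ e ^ z = -1.
Proof.
case=> ->; first by left; rewrite exp1rz.
have [k] : exists k : nat, (-1 : R) ^ z = (-1) ^+ k.
  by case: z => k; [exists k|exists k.+1; rewrite NegzE -exprz_inv invrN1].
by move=> ->; rewrite -signr_odd; case: odd; [right|left].
Qed.

Lemma cell_flip e s j y : e = 1 \/ e = -1 -> j != ord_max -> y ord0 (lift ord0 j) != 0 ->
  cell (flip_at s j) (flip_map e s j y) = cell s y.
Proof.
move=> e1 jm yj0; apply/esym/cellP.
set E := exponents a s (flip_at s j).
have yj : cplx y ord0 j = real_complex R (y ord0 (lift ord0 j)) by rewrite mxE (negPf jm).
have CE i : coord_change a s (flip_at s j) (cplx y) ord0 i =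
    Complex (coord_change a s (flip_at s j) (base y) ord0 i)
      (if i == ord_max then y ord0 ord0 * y ord0 (lift ord0 j) ^ E j ord_max else 0).
  rewrite !coord_change_flip yj; have [->|ij] := eqVneq i j.
    by rewrite (negPf jm) -fmorphV mxE.
  rewrite -fmorphXz mxE mulc_real !mxE.
  by have [->|im] := eqVneq i ord_max; rewrite ?mul0r.
have glueE w : coord_change a s (flip_at s j) (cplx y) = w -> glueC s (cplx y) (flip_at s j) w.
  move=> <-; apply/bott_glueP; split=> //= k; rewrite flip_atE => /eqP ->.
  by rewrite yj fmorph_eq0.
(* [flip_map] scales [h] by the exact factor times a power of [e]: the value 1 of this power gives
   the complex change of coordinates, the value -1 its conjugate. *)
have := sign_expz (E j ord_max) e1.
rewrite /flip_map expfzMl; case=> ->; apply/orP; [left|right]; apply: glueE; apply/rowP => i.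
  by rewrite CE [RHS]mxE hconsS hcons0 mul1r.
by rewrite CE [RHS]mxE /conjh hconsS !hcons0 base_hcons mulN1r mulrN opprK.
Qed.

Definition normsq y := y ord0 (lift ord0 ord_max) ^+ 2 + y ord0 ord0 ^+ 2.

(* The inverse of the last coordinate, conjugated so as to preserve the sign of
   [h]. *)
Definition flip_max y := hcons (y ord0 ord0 / normsq y)
  (\row_i if i == ord_max then y ord0 (lift ord0 i) / normsq y else y ord0 (lift ord0 i)).

Lemma normsq_eq0 y : (normsq y == 0) = (cplx y ord0 ord_max == 0).
Proof. by rewrite mxE eqxx eq_complex /= paddr_eq0 ?sqr_ge0 // !sqrf_eq0. Qed.

Lemma cell_flip_max s y : normsq y != 0 ->
  cell (flip_at s ord_max) (flip_max y) = cell s y.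
Proof.
(* The last coordinate z goes to z / |z|^2, the conjugate of 1/z, whence the second alternative. *)
move=> N0; apply/esym/cellP/orP; right; apply/bott_glueP; split=> /=.
  by move=> k; rewrite flip_atE => /eqP ->; rewrite -normsq_eq0.
apply/rowP => i.
have -> : cplx (conjh (flip_max y)) ord0 i =
    Complex (if i == ord_max then y ord0 (lift ord0 i) / normsq y else y ord0 (lift ord0 i))
      (if i == ord_max then - (y ord0 ord0 / normsq y) else 0).
  by rewrite mxE /conjh /flip_max hconsS !hcons0 base_hcons mxE.
rewrite coord_change_flip [cplx y ord0 ord_max]mxE [cplx y ord0 i]mxE eqxx.
have [->|im] := eqVneq i ord_max.
  by rewrite /GRing.inv /= -/(normsq y).
rewrite exponents_lower ?expr0z ?mulr1 //.
by rewrite ltn_neqAle im -ltnS ltn_ord.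
Qed.

End DiscBundle.

(** * Jacobian determinants of the flips *)

Lemma det_two_block (R : comNzRingType) (n : nat) (p q : 'I_n) (A : 'M[R]_n) : p != q ->
  (forall i j, i != j -> (i \notin [:: p; q]) || (j \notin [:: p; q]) -> A i j = 0) ->
  \det A = (A p p * A q q - A p q * A q p) * \prod_(i | (i != p) && (i != q)) A i i.
Proof.
(* Only the identity and the transposition of [p] and [q] survive in the Leibniz expansion: a
   permutation meeting no zero entry fixes every index outside the block and preserves the block. *)
move=> pq A0; rewrite /determinant (bigD1 (1%g : {perm 'I_n})) //= (bigD1 (tperm p q)) /=;
  last first.
  by apply: contraNneq pq => /permP/(_ p); rewrite tpermL perm1 => ->.
rewrite [X in _ + (_ + X)]big1 ?addr0 => [|s /andP[s1 st]].
  rewrite odd_perm1 odd_tperm pq expr0 mul1r expr1 mulN1r mulrBl.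
  congr (_ + _).
    rewrite (bigD1 p) //= (bigD1 q) 1?eq_sym //= !perm1 mulrA; congr (_ * _).
    by apply: eq_bigr => i _; rewrite perm1.
  rewrite (bigD1 p) //= (bigD1 q) 1?eq_sym //= tpermL tpermR mulrA; congr (- (_ * _)).
  by apply: eq_bigr => i /andP[ip iq]; rewrite tpermD // eq_sym.
suff [i si zi] : exists2 i, i != s i & (i \notin [:: p; q]) || (s i \notin [:: p; q]).
  by rewrite (bigD1 i) //= A0 // mul0r mulr0.
apply/exists_inP; apply: contraT; rewrite negb_exists_in => /forall_inP H.
have fixN i : i \notin [:: p; q] -> s i = i.
  by move=> ni; apply/eqP; apply: contraT => si; have := H i; rewrite eq_sym si ni => /(_ isT).
have stab i : i \in [:: p; q] -> s i \in [:: p; q].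
  move=> ii; apply: contraT => ni; have := H i; rewrite ni orbT.
  by case: eqVneq => [E|_ /(_ isT)//]; move: ni; rewrite -E ii.
have sp := stab p; have sq := stab q.
have qp : q != p by rewrite eq_sym.
rewrite !inE eqxx /= in sp; rewrite !inE eqxx orbT in sq.
have {sp} /orP[/eqP sp|/eqP sp] := sp isT.
- case/negP: s1; apply/eqP/permP => i; rewrite perm1.
  have [->//|ip] := eqVneq i p; have [->|iq] := eqVneq i q;
    last by rewrite fixN // !inE negb_or ip.
  have /orP[/eqP E|/eqP//] := sq isT.
  by move: qp; rewrite -(inj_eq (@perm_inj _ s)) E sp eqxx.
- case/negP: st; apply/eqP/permP => i.
  have [->|ip] := eqVneq i p; first by rewrite tpermL.
  have [->|iq] := eqVneq i q; last by rewrite fixN ?tpermD 1?eq_sym // !inE negb_or ip.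
  rewrite tpermR; have /orP[/eqP//|/eqP E] := sq isT.
  by move: qp; rewrite -(inj_eq (@perm_inj _ s)) E sp eqxx.
Qed.

Lemma det_first_row (R : comNzRingType) (n : nat) (A : 'M[R]_n.+1) (B : 'M[R]_n) :
  (forall i, A ord0 (lift ord0 i) = 0) ->
  (forall k i, A (lift ord0 k) (lift ord0 i) = B k i) ->
  \det A = A ord0 ord0 * \det B.
Proof.
move=> A0 AB; rewrite (expand_det_row _ ord0) big_ord_recl big1 ?addr0 => [|i _]; last first.
  by rewrite A0 mul0r.
rewrite /cofactor /= expr0 mul1r; congr (_ * \det _).
by apply/matrixP => k i; rewrite !mxE AB.
Qed.

Section Derive.
Context {R : realType}.

Lemma derive_affine (n : nat) (f : 'rV[R]_n -> R) (v y : 'rV[R]_n) (l : R) :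
  (forall t : R, f (t *: v + y) = f y + t * l) -> 'D_v f y = l.
Proof.
move=> fE; rewrite /derive; apply: cvg_lim; first exact: Rhausdorff.
apply: cvg_near_cst; near=> h.
have h0 : h != 0 by near: h; exact: nbhs_dnbhs_neq.
by rewrite /= fE [f y + _]addrC addrK /GRing.scale /= mulrA mulVf ?mul1r.
Unshelve. all: by end_near. Qed.

Lemma derive_coord (n : nat) (v y : 'rV[R]_n) (i : 'I_n) :
  'D_v (fun z : 'rV[R]_n => z ord0 i : R) y = v ord0 i.
Proof. by apply: derive_affine => t; rewrite !mxE addrC. Qed.

Lemma derive_div (n : nat) (f g : 'rV[R]_n -> R) (v y : 'rV[R]_n) :
  differentiable f y -> differentiable g y -> g y != 0 ->
  'D_v (fun z => f z / g z) y = ('D_v f y * g y - f y * 'D_v g y) / g y ^+ 2.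
Proof.
move=> df dg g0.
have df' : derivable f y v by exact: diff_derivable.
have dg' : derivable g y v by exact: diff_derivable.
have dV : derivable (fun z => (g z)^-1) y v by exact: derivableV.
rewrite [LHS](deriveM df' dV) (deriveV g0 dg') /GRing.scale /=.
by field.
Qed.

End Derive.

Section Flips.
Variables (R : realType) (m : nat) (a : 'M[int]_m.+1).
Implicit Types (s t : @bott_cone m.+1) (y z : 'rV[R]_m.+2) (x : 'rV[R]_m.+1) (i j : 'I_m.+1).

Lemma Cinfty_hcons (U : set 'rV[R]_m.+2) (h : 'rV[R]_m.+2 -> R) (f : 'rV[R]_m.+2 ->
  'rV[R]_m.+1) :
  open U -> (forall k, Ckr k U h) -> Cinfty U f -> Cinfty U (fun y => hcons (h y) (f y)).
Proof.
move=> oU Ch Cf k; apply/CkP => // l; case: (unliftP ord0 l) => [i ->|->].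
  by apply: (Ckr_ext oU) ((CkP k f oU).1 (Cf k) i) => y _; rewrite hconsS.
by apply: (Ckr_ext oU) (Ch k) => y _; rewrite hcons0.
Qed.

Definition base_mx : 'M[R]_(m.+2, m.+1) := \matrix_(k, i) (k == lift ord0 i)%:R.

Lemma base_mulmx y : base y = y *m base_mx.
Proof.
apply/rowP => i; rewrite !mxE (bigD1 (lift ord0 i)) //= mxE eqxx mulr1 big1 ?addr0 // => k ki.
by rewrite mxE (negPf ki) mulr0.
Qed.

Lemma base_fun : @base R m = (fun y => y *m base_mx).
Proof. by apply/funext => y; rewrite base_mulmx. Qed.

Lemma base_mx_mul (k : nat) (A : 'M[R]_(m.+1, k)) :
  (forall l, (base_mx *m A) ord0 l = 0) /\
  (forall i l, (base_mx *m A) (lift ord0 i) l = A i l).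
Proof.
split=> [l|i l]; rewrite mxE; first by rewrite big1 // => i _; rewrite mxE mul0r.
rewrite (bigD1 i) //= mxE eqxx mul1r big1 ?addr0 // => k' ki.
by rewrite mxE (inj_eq (@lift_inj _ _)) eq_sym (negPf ki) mul0r.
Qed.

Lemma open_coord_neq0 (n : nat) (i : 'I_n) : open [set x : 'rV[R]_n | x ord0 i != 0].
Proof.
rewrite (_ : [set _ | _] = (fun x : 'rV[R]_n => x ord0 i) @^-1` [set r | r != 0]) //.
apply: open_comp; last exact: open_neq.
by move=> x _; exact: coord_continuous.
Qed.

Lemma Cinfty_coord_change_flip s j :
  Cinfty [set x : 'rV[R]_m.+1 | x ord0 j != 0] (coord_change a s (flip_at s j)).
Proof.
have oU := @open_coord_neq0 m.+1 j.
move=> k; apply/CkP => // i.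
have [ij|ij] := eqVneq i j.
  apply: (Ckr_ext oU) (CkrV oU _ (Ckr_coord _ _ j)) => [x _|//].
  by rewrite coord_change_flip ij eqxx.
apply: (Ckr_ext oU) (CkrM oU (Ckr_coord _ _ i) (Ckr_expz (exponents a s (flip_at s j) j i)
  oU _ (Ckr_coord _ _ j))) => [x _|//].
by rewrite coord_change_flip (negPf ij).
Qed.

Definition flip_dom (e : R) j : set 'rV[R]_m.+2 := [set y | 0 < e * y ord0 (lift ord0 j)].

Lemma open_flip_dom e j : open (flip_dom e j).
Proof.
rewrite (_ : flip_dom e j = (fun y : 'rV[R]_m.+2 =>
  e * y ord0 (lift ord0 j)) @^-1` [set r | 0 < r]) //.
apply: open_comp; last exact: open_gt.
by move=> x _; apply: continuousM; [exact: cst_continuous|exact: coord_continuous].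
Qed.

Lemma flip_dom_neq0 e j y : flip_dom e j y -> y ord0 (lift ord0 j) != 0.
Proof. by move=> d; apply/eqP => y0; move: d; rewrite /flip_dom /= y0 mulr0 ltxx. Qed.

Lemma Cinfty_base_comp s j (U : set 'rV[R]_m.+2) : open U ->
  (forall y, U y -> y ord0 (lift ord0 j) != 0) ->
  Cinfty U (fun y => coord_change a s (flip_at s j) (base y)).
Proof.
move=> oU U0.
apply: (@Cinfty_comp R _ _ _ U _ (@base R m) _ oU (@open_coord_neq0 _ j) _ _
  (@Cinfty_coord_change_flip s j)).
  by move=> y /U0; rewrite /= mxE.
by rewrite base_fun; exact: Cinfty_mulmxr.
Qed.

Lemma Ckr_flip_scale e s j k : Ckr k (flip_dom e j)
  (fun y => (e * y ord0 (lift ord0 j)) ^ exponents a s (flip_at s j) j ord_max).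
Proof.
have oU := @open_flip_dom e j.
apply: Ckr_expz => //; first by move=> y /lt0r_neq0.
by apply: CkrM => //; [exact: Ckr_cst|exact: Ckr_coord].
Qed.

Lemma Cinfty_flip_map e s j : Cinfty (flip_dom e j) (flip_map a e s j).
Proof.
have oU := @open_flip_dom e j.
apply: Cinfty_hcons => //.
  by move=> k; apply: CkrM => //; [exact: Ckr_coord|exact: Ckr_flip_scale].
by apply: Cinfty_base_comp => //; exact: flip_dom_neq0.
Qed.

(** The components other than the first do not involve [h], so the Jacobian is block triangular; its
    corner is the scale of [h], positive on [flip_dom]. *)
Lemma det_flip_map e s j y : j != ord_max -> flip_dom e j y ->
  \det (jacobian (flip_map a e s j) y) =
  (e * y ord0 (lift ord0 j)) ^ exponents a s (flip_at s j) j ord_max *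
  \det (jacobian (coord_change a s (flip_at s j)) (base y)).
Proof.
move=> jm Uy.
have dF := Cinfty_differentiable (@Cinfty_flip_map e s j) Uy.
have yj0 := flip_dom_neq0 Uy.
have db : differentiable (@base R m) y.
  by rewrite base_fun; exact: (jacobian_mulmxr _ _).1.
have dC : differentiable (coord_change a s (flip_at s j)) (base y).
  by apply: (Cinfty_differentiable (@Cinfty_coord_change_flip s j)); rewrite /= mxE.
have dCb : differentiable (coord_change a s (flip_at s j) \o @base R m) y
  by exact: differentiable_comp.
have JS k i : jacobian (flip_map a e s j) y k (lift ord0 i) =
    (base_mx *m jacobian (coord_change a s (flip_at s j)) (base y)) k i.
  have <- : jacobian (coord_change a s (flip_at s j) \o @base R m) y =
     base_mx *m jacobian (coord_change a s (flip_at s j)) (base y).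
    apply: etrans (jacobian_comp db dC) _; congr (_ *m _).
    by rewrite base_fun; exact: (jacobian_mulmxr _ _).2.
  apply: etrans (jacobianE _ _ dF) (etrans _ (esym (jacobianE _ _ dCb))).
  have E : (fun z => flip_map a e s j z ord0 (lift ord0 i)) =
      (fun z => (coord_change a s (flip_at s j) \o @base R m) z ord0 i).
    by apply/funext => z; rewrite /= hconsS.
  exact: (congr1 (fun f => 'D_(delta_mx ord0 k) f y) E).
have [M0 MS] := base_mx_mul (jacobian (coord_change a s (flip_at s j)) (base y)).
have J0 : jacobian (flip_map a e s j) y ord0 ord0 =
    (e * y ord0 (lift ord0 j)) ^ exponents a s (flip_at s j) j ord_max.
  apply: etrans (jacobianE _ _ dF) _; apply: derive_affine => t.
  by rewrite !hcons0 !mxE /= mulr0 mulr1 add0r mulrDl addrC.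
rewrite -J0; apply: det_first_row => [i|k i]; first exact: etrans (JS _ _) (M0 _).
exact: etrans (JS _ _) (MS _ _).
Qed.

Lemma flip_map0 e s j y : flip_dom e j y ->
  exists2 c : R, 0 < c & flip_map a e s j y ord0 ord0 = c * y ord0 ord0.
Proof.
move=> Uy; exists ((e * y ord0 (lift ord0 j)) ^ exponents a s (flip_at s j) j ord_max).
  exact: exprz_gt0.
by rewrite hcons0 mulrC.
Qed.

Definition max_dom : set 'rV[R]_m.+2 := [set y | normsq y != 0].

Lemma Ckr_normsq k U : open U -> Ckr k U (@normsq R m).
Proof.
move=> oU; rewrite /normsq; apply: CkrD => //.
  by apply: (Ckr_ext oU) (CkrM oU (Ckr_coord _ _ _) (Ckr_coord _ _ _)) => y _; rewrite expr2.
by apply: (Ckr_ext oU) (CkrM oU (Ckr_coord _ _ _) (Ckr_coord _ _ _)) => y _; rewrite expr2.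
Qed.

Lemma open_max_dom : open max_dom.
Proof.
rewrite (_ : max_dom = @normsq R m @^-1` [set r | r != 0]) //.
apply: open_comp; last exact: open_neq.
move=> y _; exact: (@Ckr_normsq 0 setT openT y I).
Qed.

Lemma Cinfty_flip_max : Cinfty max_dom (@flip_max R m).
Proof.
have oU := open_max_dom.
have CV k : Ckr k max_dom (fun y => (normsq y)^-1).
  by apply: CkrV => //; exact: Ckr_normsq.
apply: Cinfty_hcons => //.
  by move=> k; apply: CkrM => //; exact: Ckr_coord.
move=> k; apply/CkP => // i; have [->|im] := eqVneq i ord_max.
  by apply: (Ckr_ext oU) (CkrM oU (Ckr_coord _ _ (lift ord0 ord_max)) (CV k)) => y _;
    rewrite mxE eqxx.
by apply: (Ckr_ext oU) (Ckr_coord _ _ (lift ord0 i)) => y _; rewrite mxE (negPf im).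
Qed.

Lemma flip_max0 y : max_dom y ->
  exists2 c : R, 0 < c & flip_max y ord0 ord0 = c * y ord0 ord0.
Proof.
move=> Uy; exists (normsq y)^-1; last by rewrite hcons0 mulrC.
by rewrite invr_gt0 lt_def Uy /normsq addr_ge0 ?sqr_ge0.
Qed.

End Flips.

Section FlipMax.
Variables (R : realType) (m : nat) (a : 'M[int]_m.+1).
Implicit Types (s t : @bott_cone m.+1) (y z v : 'rV[R]_m.+2) (x : 'rV[R]_m.+1) (i j : 'I_m.+1).

Let q : 'I_m.+2 := lift ord0 ord_max.

Lemma derive_normsq v y :
  'D_v (@normsq R m) y = (y ord0 q * v ord0 q + y ord0 ord0 * v ord0 ord0) * 2.
Proof.
have dc k : derivable (fun z : 'rV[R]_m.+2 => z ord0 k : R) y v.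
  by apply: diff_derivable; exact: differentiable_coord.
have dM k : derivable ((fun z : 'rV[R]_m.+2 => z ord0 k : R) * (fun z => z ord0 k)) y v.
  exact: derivableM.
have -> : @normsq R m = (fun z => z ord0 q : R) * (fun z => z ord0 q) +
     (fun z => z ord0 ord0) * (fun z => z ord0 ord0).
  by apply/funext => z; rewrite /normsq -!expr2.
rewrite deriveD // !deriveM // !derive_coord /GRing.scale /=; ring.
Qed.

Lemma derive_coord_normsq v y k : max_dom y ->
  'D_v (fun z => z ord0 k / normsq z : R) y =
  (v ord0 k * normsq y - y ord0 k * ((y ord0 q * v ord0 q + y ord0 ord0 * v ord0 ord0) * 2))
    / normsq y ^+ 2.
Proof.
move=> y0; rewrite derive_div //; first by rewrite derive_coord derive_normsq.
  exact: differentiable_coord.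
by have [+ _] := @Ckr_normsq R m 1 setT openT; apply.
Qed.

(** In the plane of [h] and the last coordinate the map is v |-> v / |v|^2, whose differential is a
    reflection scaled by |v|^-2; the other coordinates contribute an identity block. The determinant
    is -|v|^-4. *)
Lemma det_flip_max y : max_dom y -> \det (jacobian (@flip_max R m) y) < 0.
Proof.
move=> y0; have dF := Cinfty_differentiable (@Cinfty_flip_max R m) y0.
have J1 k i : i != ord_max ->
  jacobian (@flip_max R m) y k (lift ord0 i) = (k == lift ord0 i)%:R.
  move=> im; apply: etrans (jacobianE _ _ dF) _.
  have -> : (fun z => flip_max z ord0 (lift ord0 i)) = (fun z : 'rV[R]_m.+2 =>
    z ord0 (lift ord0 i)).
    by apply/funext => z; rewrite hconsS mxE (negPf im).
  by rewrite derive_coord mxE eqxx eq_sym.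
have J2 k l : l \in [:: ord0; q] -> jacobian (@flip_max R m) y k l =
    'D_(delta_mx ord0 k) (fun z => z ord0 l / normsq z : R) y.
  move=> lq; apply: etrans (jacobianE _ _ dF) _.
  suff E : (fun z => flip_max z ord0 l) = (fun z => z ord0 l / normsq z) by rewrite E.
  apply/funext => z; move: lq; rewrite !inE => /orP[/eqP->|/eqP->]; first by rewrite hcons0.
  by rewrite hconsS mxE eqxx.
have q0 : q != ord0 by rewrite eq_sym neq_lift.
pose J : 'M[R]_m.+2 := \matrix_(k, l)
  if l \in [:: ord0; q] then 'D_(delta_mx ord0 k) (fun z => z ord0 l / normsq z : R) y
  else (k == l)%:R.
have JE : jacobian (@flip_max R m) y = J.
  apply/matrixP => k l; rewrite [RHS]mxE; case: ifP => lq; first exact: J2.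
  case: (unliftP ord0 l) lq => [i ->|->]; last by rewrite !inE eqxx.
  move=> iq; apply: J1; apply: contraFneq iq => ->.
  by rewrite !inE eqxx orbT.
have -> : \det (jacobian (@flip_max R m) y) = \det J by congr (\det _).
rewrite (@det_two_block _ _ ord0 q) 1?eq_sym // => [|k l kl]; last first.
  rewrite mxE; have [lq|_ _] := boolP (l \in _); last by rewrite (negPf kl).
  rewrite orbF !inE negb_or => /andP[k0 kq].
  rewrite derive_coord_normsq // !mxE eqxx /=.
  rewrite (eq_sym q) (negPf kq) (eq_sym ord0) (negPf k0) (eq_sym l) (negPf kl).
  by rewrite !(mulr0, mul0r, addr0, subr0).
rewrite big1 => [|k /andP[k0 kq]]; last by rewrite mxE !inE (negPf k0) (negPf kq) eqxx.
rewrite mulr1 !mxE !inE !eqxx !orbT !derive_coord_normsq // !mxE !eqxx (negPf q0).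
rewrite eq_sym (negPf q0) /=.
set X := y ord0 q; set H := y ord0 ord0.
have NE : normsq y = X ^+ 2 + H ^+ 2 by [].
have N0 : X ^+ 2 + H ^+ 2 != 0 by rewrite -NE.
rewrite NE.
rewrite [Z in Z < 0](_ : _ = - (X ^+ 2 + H ^+ 2) ^- 2); last by field.
by rewrite oppr_lt0 invr_gt0 lt_def sqr_ge0 expf_neq0.
Qed.

(** One sample point is enough: with the hypothesis [eps_flip] it determines the sign of
    [eps s * eps (flip_at s ord_max)], which does not depend on the point. *)
Lemma det_coord_change_flip_max s :
  \det (jacobian (coord_change a s (flip_at s ord_max)) (const_mx 1 : 'rV[R]_m.+1)) < 0.
Proof.
set x := const_mx 1; set F := coord_change _ _ _.
have x0 : [set x : 'rV[R]_m.+1 | x ord0 ord_max != 0] x by rewrite /= mxE oner_eq0.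
have dF := Cinfty_differentiable (@Cinfty_coord_change_flip R m a s ord_max) x0.
pose J : 'M[R]_m.+1 := \matrix_(k, l) if k == l then if k == ord_max then -1 else 1 else 0.
have JE : jacobian F x = J.
  apply/matrixP => k l; rewrite [RHS]mxE.
  apply: etrans (jacobianE _ _ dF) _.
  have [->|lm] := eqVneq l ord_max.
    have -> : (fun y : 'rV[R]_m.+1 => coord_change a s (flip_at s ord_max) y ord0 ord_max) =
        (fun y : 'rV[R]_m.+1 => 1 / y ord0 ord_max).
      by apply/funext => w; rewrite coord_change_flip eqxx mul1r.
    have d1 : differentiable (cst (1 : R) : 'rV[R]_m.+1 -> R) x by exact: differentiable_cst.
    have dq : differentiable (fun w : 'rV[R]_m.+1 =>
      w ord0 ord_max : R) x by exact: differentiable_coord.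
    rewrite (derive_div _ d1 dq x0).
    rewrite derive_cst derive_coord !mxE eqxx /= eq_sym.
    rewrite mul0r sub0r mul1r expr1n divr1.
    by case: (k == ord_max); rewrite ?oppr0.
  have -> : (fun y : 'rV[R]_m.+1 => coord_change a s (flip_at s ord_max) y ord0 l) =
        (fun y : 'rV[R]_m.+1 => y ord0 l).
    apply/funext => w; rewrite coord_change_flip (negPf lm) exponents_lower ?expr0z ?mulr1 //.
    by rewrite ltn_neqAle lm -ltnS ltn_ord.
  rewrite derive_coord mxE eqxx /= eq_sym; have [->|_] := eqVneq k l; last by [].
  by rewrite (negPf lm).
have -> : \det (jacobian F x) = \det J by congr (\det _).
rewrite det_trig; last first.
  by apply/is_trig_mxP => i j ij; rewrite mxE -val_eqE /= (ltn_eqF ij).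
rewrite (bigD1 ord_max) //= big1 => [|i im]; last by rewrite mxE eqxx (negPf im).
by rewrite mxE !eqxx mulr1 oppr_lt0.
Qed.

End FlipMax.

(** * Local transition maps and their signs *)

Section Germs.
Variables (R : realType) (m : nat) (a : 'M[int]_m.+1) (eps : @bott_cone m.+1 -> R).
Implicit Types (s t u : @bott_cone m.+1) (y z : 'rV[R]_m.+2) (x : 'rV[R]_m.+1) (i j : 'I_m.+1).

(** [eps s] stands for the sign of the affine chart of [s] relative to the given orientation;
    [eps_flip] expresses that the flips on Y_n are compatible with these signs. *)
Hypothesis eps1 : forall s, eps s = 1 \/ eps s = -1.
Hypothesis eps_flip : forall s j x, x ord0 j != 0 ->
  0 < eps s * eps (flip_at s j) * \det (jacobian (coord_change a s (flip_at s j)) x).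

(* [g] is the transition map from the chart of [s] to that of [t] near [y], chosen
   to preserve the half-space [h <= 0]. *)
Definition germ s t y (U : set 'rV[R]_m.+2) (g : 'rV[R]_m.+2 -> 'rV[R]_m.+2) : Prop :=
  [/\ open U, U y, Cinfty U g,
      forall z, U z -> cell a t (g z) = cell a s z /\
        exists2 c : R, 0 < c & g z ord0 ord0 = c * z ord0 ord0 &
      0 < eps s * eps t * \det (jacobian g y)].

Lemma eps_sqr s : eps s * eps s = 1.
Proof. by case: (eps1 s) => ->; rewrite ?mulrNN mulr1. Qed.

Lemma germ_refl s y : germ s s y setT (fun z => z *m 1%:M).
Proof.
split=> //; first exact: openT.
- exact: Cinfty_mulmxr openT.
- by move=> z _; rewrite mulmx1; split=> //; exists 1; rewrite ?mul1r.
- have -> : \det (jacobian (fun z : 'rV[R]_m.+2 => z *m 1%:M) y) = 1.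
    by rewrite (jacobian_mulmxr _ _).2 det1.
  by rewrite eps_sqr mulr1.
Qed.

Lemma germ_comp s t u y U g V h : germ s t y U g -> germ t u (g y) V h ->
  germ s u y (U `&` g @^-1` V) (h \o g).
Proof.
move=> [oU Uy Cg gE dg] [oV Vy Ch hE dh].
have oW : open (U `&` g @^-1` V).
  by apply: (open_setI_preimage oU oV) => x Ux; exact: Cinfty_continuous Cg Ux.
split.
- exact: oW.
- by split.
- apply: (@Cinfty_comp _ _ _ _ _ V) => // [x []//|].
  by apply: Cinfty_sub Cg => // x [].
- move=> z [Uz Vz]; have [cz [c c0 ez]] := gE z Uz; have [cz' [c' c0' ez']] := hE _ Vz.
  split; first by rewrite /= cz' cz.
  by exists (c' * c); [exact: mulr_gt0|rewrite /= ez' ez mulrA].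
- have J := jacobian_comp (Cinfty_differentiable Cg Uy) (Cinfty_differentiable Ch Vy).
  have -> : eps s * eps u = (eps s * eps t) * (eps t * eps u).
    by rewrite mulrA -[eps s * eps t * eps t]mulrA eps_sqr mulr1.
  exact: signed_det_mul J dg dh.
Qed.

Lemma germ_flip s j y : cplx y ord0 j != 0 -> exists U g, germ s (flip_at s j) y U g.
Proof.
have [->|jm] := eqVneq j ord_max.
  rewrite -normsq_eq0 => y0; exists (@max_dom R m), (@flip_max R m); split.
  - exact: open_max_dom.
  - exact: y0.
  - exact: Cinfty_flip_max.
  - by move=> z z0; split; [exact: cell_flip_max|exact: flip_max0].
  (* [eps_flip] cannot be applied at [base y], whose last coordinate may vanish when [h] does not.
     The all-ones point shows instead that the product of the two signs is negative. *)
  - have x0 : (const_mx 1 : 'rV[R]_m.+1) ord0 ord_max != 0 by rewrite mxE oner_eq0.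
    have := eps_flip s x0; rewrite nmulr_lgt0; last exact: det_coord_change_flip_max.
    by move=> e0; rewrite nmulr_rgt0 //; exact: det_flip_max.
rewrite mxE (negPf jm) => yc.
have y0 : y ord0 (lift ord0 j) != 0 by apply: contra_neq yc => ->.
have [e e1 ye] : exists2 e : R, e = 1 \/ e = -1 & flip_dom e j y.
  by case: (neq0_sign_or y0) => h; [exists 1|exists (-1)]; auto.
exists (flip_dom e j), (flip_map a e s j); split.
- exact: open_flip_dom.
- exact: ye.
- exact: Cinfty_flip_map.
- move=> z z0; split; last exact: flip_map0.
  by apply: cell_flip => //; exact: flip_dom_neq0 z0.
- rewrite det_flip_map // mulrCA; apply: mulr_gt0; first exact: exprz_gt0.
  by apply: eps_flip; rewrite mxE.
Qed.

(** Flip the differing bits one at a time, by induction on their number. A flip of bit [j] does not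
    affect whether the other coordinates vanish, so the remaining flips stay defined. *)
Lemma germ_exists s t y : (forall k, s k != t k -> cplx y ord0 k != 0) ->
  exists U g, germ s t y U g.
Proof.
have [N] := ubnP #|[pred k | s k != t k]|; elim: N s y => // N IH s y; rewrite ltnS => sN y0.
have [j sj|st] := pickP (fun k => s k != t k); last first.
  have -> : t = s by apply/ffunP => k; apply/esym/eqP; rewrite -[_ == _]negbK st.
  by exists setT, (fun z => z *m 1%:M); exact: germ_refl.
have [U [g G]] := germ_flip s (y0 j sj).
have [oU Uy _ gE _] := G; have [gy _] := gE y Uy.
have fj k : flip_at s j k != t k -> k != j /\ s k != t k.
  rewrite ffunE; have [->|//] := eqVneq k j.
  by move: sj; case: (s j); case: (t j).
have [||V [h H]] := IH (flip_at s j) (g y).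
- apply: leq_trans sN; apply: proper_card; apply/properP; split.
    by apply/fintype.subsetP => k; rewrite !inE => /fj[].
  by exists j; rewrite !inE //; apply/negP => /fj[]; rewrite eqxx.
- move=> k /fj[kj sk]; rewrite (cell_neq0_shared (esym gy)); first exact: y0.
  by apply/eqP; rewrite -[_ == _]negbK flip_atE.
by exists (U `&` g @^-1` V), (h \o g); exact: germ_comp G H.
Qed.

Lemma germ_cell s t y z : cell a s y = cell a t z -> exists U g, germ s t y U g.
Proof. by move=> E; apply: germ_exists => k; exact: cell_neq0 E. Qed.

End Germs.

Lemma second_countable_rV (R : realType) (n : nat) : @second_countable 'rV[R]_n.
Proof.
pose B (qk : 'rV[rat]_n * nat) : set 'rV[R]_n :=
  @ball R 'rV[R]_n (map_mx ratr qk.1) (qk.2.+1%:R^-1).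
exists (range B); first by apply: sub_countable (card_image_le B setT) _; exact: countableP.
split; first by move=> _ [qk _ <-]; exact: ball_open.
move=> x V /nbhs_ballP[e /= e0 xeV].
have [k ke] : exists k, k.+1%:R^-1 < e / 2 :> R.
  have e20 : 0 < e / 2 by rewrite divr_gt0.
  exists (Num.truncn (e / 2)^-1).
  by rewrite invf_plt ?posrE // truncnS_gt.
have k0 : 0 < k.+1%:R^-1 :> R by rewrite invr_gt0.
have qex i : exists q : rat, ball (ratr q : R) (k.+1%:R^-1) (x ord0 i).
  have /rat_in_itvoo[q] : x ord0 i - k.+1%:R^-1 < x ord0 i + k.+1%:R^-1.
    by rewrite ltrD2l gtrN.
  rewrite in_itv /= => /andP[q1 q2]; exists q.
  rewrite /ball /= ltr_norml; move: q1 q2; set d := _^-1 => q1 q2. apply/andP; split; lra.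
pose q : 'rV[rat]_n := \row_i xchoose (qex i).
have Bx : B (q, k) x.
  by split=> // i j; rewrite (ord1 i) !mxE; exact: (xchooseP (qex j)).
exists (B (q, k)); first by split=> //; exists (q, k).
move=> z Bz; apply: xeV; apply: ball_splitr (le_ball (ltW ke) Bx) (le_ball (ltW ke) Bz).
Qed.

(** * Topology of the disc bundle *)

Section Cells.
Variables (R : realType) (m : nat) (a : 'M[int]_m.+1).
Implicit Types (s t u : @bott_cone m.+1) (y z : 'rV[R]_m.+2) (x : 'rV[R]_m.+1) (i j k :
  'I_m.+1).

Lemma cell_continuous s : continuous (@cell R m a s).
Proof.
by apply/continuousP => V; rewrite {1}/open /= /quotient_open => /sigT_openP /(_ s).
Qed.

Lemma open_cellP (V : set (disc_bundle R a)) : open V <-> forall s, open (cell a s @^-1` V).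
Proof.
split=> [oV s|oV]; first by apply: open_comp oV => y _; exact: cell_continuous.
rewrite /open /= /quotient_open; apply/sigT_openP => s; exact: oV.
Qed.

Lemma affine_chart_continuous s : continuous (@affine_chart R m.+1 a s).
Proof.
by apply/continuousP => V; rewrite {1}/open /= /quotient_open => /sigT_openP /(_ s).
Qed.

Lemma affine_chart_surj (p : real_bott R a) : exists s x, p = affine_chart a s x.
Proof. by rewrite -[p]reprK; case: (repr p) => s x; exists s, x. Qed.

Lemma affine_chart_inj s : injective (@affine_chart R m.+1 a s).
Proof.
move=> x x' /cell_real/cell_inj; rewrite /conjh hcons0 oppr0 base_hcons.
by case=> /(congr1 (@base R m)); rewrite !base_hcons.
Qed.

Lemma real_bott_continuous (T : topologicalType) (f : real_bott R a -> T) :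
  (forall s, continuous (f \o affine_chart a s)) -> continuous f.
Proof.
move=> cf; apply/continuousP => V oV; rewrite /open /= /quotient_open.
apply/sigT_openP => s; have /continuousP := cf s; exact.
Qed.

Lemma continuous_hcons (T : topologicalType) (h : T -> R) (f : T -> 'rV[R]_m.+1) p :
  {for p, continuous h} -> {for p, continuous f} ->
  {for p, continuous (fun q => hcons (h q) (f q))}.
Proof.
move=> ch cf; apply/continuous_rowP => k; case: (unliftP ord0 k) => [i ->|->].
  have -> : (fun q => hcons (h q) (f q) ord0 (lift ord0 i)) = (fun q => f q ord0 i).
    by apply/funext => q; rewrite hconsS.
  by move: i; apply/continuous_rowP.
have -> // : (fun q => hcons (h q) (f q) ord0 ord0) = h.
by apply/funext => q; rewrite hcons0.
Qed.

Lemma base_continuous : continuous (@base R m).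
Proof.
move=> y; apply/continuous_rowP => i.
rewrite (_ : (fun _ => _) = (fun z : 'rV[R]_m.+2 => z ord0 (lift ord0 i))).
  exact: coord_continuous.
by apply/funext => z; rewrite mxE.
Qed.

Lemma conjh_continuous : continuous (@conjh R m).
Proof.
move=> y.
apply: (@continuous_hcons _ (fun z : 'rV[R]_m.+2 => - z ord0 ord0) (@base R m));
  last exact: base_continuous.
by apply: continuousN; exact: coord_continuous.
Qed.

(** The continuous choice of the representative with [h <= 0] in each class modulo [conjh]. *)
Definition fold y := hcons (- `|y ord0 ord0|) (base y).

Lemma fold_continuous : continuous fold.
Proof.
move=> y.
apply: (@continuous_hcons _ (fun z : 'rV[R]_m.+2 => - `|z ord0 ord0|) (@base R m));
  last exact: base_continuous.
apply: continuousN; apply: (@continuous_comp _ _ _ (fun z : 'rV[R]_m.+2 => z ord0 ord0 : R)).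
  exact: coord_continuous.
exact: norm_continuous.
Qed.

Lemma fold_le0 y : fold y ord0 ord0 <= 0.
Proof. by rewrite hcons0 oppr_le0. Qed.

Lemma fold_id y : y ord0 ord0 <= 0 -> fold y = y.
Proof. by move=> y0; rewrite /fold ler0_norm // opprK hcons_base. Qed.

Lemma foldE y : fold y = y \/ fold y = conjh y.
Proof.
have [y0|/ltW y0] := lerP (y ord0 ord0) 0; first by left; exact: fold_id.
by right; rewrite /fold ger0_norm.
Qed.

Lemma fold_conjh y : fold (conjh y) = fold y.
Proof. by rewrite /fold /conjh hcons0 base_hcons normrN. Qed.

Lemma cell_fold s y : cell a s (fold y) = cell a s y.
Proof. by case: (foldE y) => -> //; rewrite cell_conjh. Qed.

Lemma fold_cell s y z : cell a s y = cell a s z -> fold y = fold z.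
Proof. by move=> /cell_inj[]-> //; rewrite fold_conjh. Qed.

Definition sqnorm (c : R[i]) : R := complex.Re c ^+ 2 + complex.Im c ^+ 2.

Lemma sqnormM c d : sqnorm (c * d) = sqnorm c * sqnorm d.
Proof. case: c d => [p q] [r w]; rewrite /sqnorm; simpc => /=; ring. Qed.

Lemma sqnormV c : c != 0 -> sqnorm c * sqnorm c^-1 = 1.
Proof. by move=> c0; rewrite -sqnormM mulfV // /sqnorm /= expr1n expr0n addr0. Qed.

Lemma sqnorm_conj c : sqnorm (conjc c) = sqnorm c.
Proof. by case: c => p q; rewrite /sqnorm /= sqrrN. Qed.

Definition nrm y i : R := sqnorm (cplx y ord0 i).

(** By triangularity coordinates after [i] do not enter, and agreement of the earlier bits gives the
    earlier coordinates exponent 0. Only the exponent 1 or -1 of coordinate [i] remains, and moduli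
    ignore the conjugation ambiguity of [cell]. *)
Lemma nrm_cell s t y z i : cell a s y = cell a t z ->
  (forall k, (k < i)%N -> s k = t k) ->
  if s i == t i then nrm z i = nrm y i else nrm y i * nrm z i = 1.
Proof.
move=> yz st.
have [w wz glue] : exists2 w, nrm w i = nrm z i & glueC a s (cplx y) t (cplx w).
  case/cellP/orP: yz => h; [exists z|exists (conjh z)] => //.
  by rewrite /nrm cplx_conjh mxE sqnorm_conj.
have y0 : s i != t i -> cplx y ord0 i != 0 by move: yz; exact: cell_neq0.
rewrite -wz {wz}; have /bott_glueP/= [_ E] := glue.
have : cplx w ord0 i = cplx y ord0 i ^ exponents a s t i i.
  rewrite E mxE (bigD1 i) //= big1 ?mulr1 // => k ki.
  have [ik|ik] := ltnP i k; first by rewrite exponents_lower // expr0z.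
  rewrite exponents_shared ?(negPf ki) ?expr0z //.
  by apply: st; rewrite ltn_neqAle ki.
rewrite exponents_diag /nrm; case: eqVneq => [_|/y0 yi0] ->; first by rewrite expr1z.
by rewrite exprN1 sqnormV.
Qed.

Lemma nrm_ge0 y i : 0 <= nrm y i.
Proof. by rewrite /nrm /sqnorm addr_ge0 ?sqr_ge0. Qed.

Lemma nrm_eq0 y i : (nrm y i == 0) = (cplx y ord0 i == 0).
Proof.
by rewrite /nrm /sqnorm paddr_eq0 ?sqr_ge0 // !sqrf_eq0 eq_complex.
Qed.

Lemma open_nrm_lt1 i : open [set y | nrm y i < 1].
Proof.
rewrite (_ : [set _ | _] = nrm^~ i @^-1` [set r | r < 1]) //.
apply: open_comp; last exact: open_lt.
move=> y _.
pose f (z : 'rV[R]_m.+2) : R := z ord0 (lift ord0 i) * z ord0 (lift ord0 i) +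
  (if i == ord_max then z ord0 ord0 * z ord0 ord0 else 0).
have -> : nrm^~ i = f.
  by apply/funext => z; rewrite /nrm /sqnorm mxE /f /= !expr2; case: ifP; rewrite ?mulr0.
have /(_ y I) : Ckr 0 setT f; last by apply.
apply: CkrD; first exact: openT.
  by apply: CkrM; [exact: openT|exact: Ckr_coord|exact: Ckr_coord].
case: (i == ord_max); last exact: Ckr_cst.
by apply: CkrM; [exact: openT|exact: Ckr_coord|exact: Ckr_coord].
Qed.

Section Orientable.
Variable eps : @bott_cone m.+1 -> R.
Hypothesis eps1 : forall s, eps s = 1 \/ eps s = -1.
Hypothesis eps_flip : forall s j x, x ord0 j != 0 ->
  0 < eps s * eps (flip_at s j) * \det (jacobian (coord_change a s (flip_at s j)) x).

Lemma cell_change s t y : (forall k, s k != t k -> cplx y ord0 k != 0) ->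
  exists z, cell a t z = cell a s y.
Proof.
move=> /(germ_exists eps1 eps_flip)[U [g [_ Uy _ gE _]]].
by exists (g y); have [] := gE y Uy.
Qed.

(** Seen in the chart of [t], a neighbourhood of [y] in the image of [V] is formed by the points
    that the germ [g] sends into [V] or its conjugate, since conjugate vectors name the same
    point. *)
Lemma cell_open s (V : set 'rV[R]_m.+2) : open V -> open (cell a s @` V).
Proof.
move=> oV; apply/open_cellP => t; rewrite openE => y [x Vx xy].
have [U [g [oU Uy Cg gE _]]] := germ_cell eps1 eps_flip (esym xy).
pose V' := V `|` @conjh R m @^-1` V.
have oV' : open V'.
  by apply: openU => //; apply: open_comp oV => z _; exact: conjh_continuous.
have oW : open (U `&` g @^-1` V').
  by apply: (open_setI_preimage oU oV') => z Uz; exact: Cinfty_continuous Cg Uz.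
have Wy : (U `&` g @^-1` V') y.
  split=> //=; have [gy _] := gE y Uy.
  by move: gy; rewrite -xy => /cell_inj[] xE; [left|right]; rewrite /= -xE.
have N : nbhs y (U `&` g @^-1` V') by exact: open_nbhs_nbhs.
apply: filterS N => z [Uz [Vz|Vz]]; have [gz _] := gE z Uz.
  by exists (g z).
by exists (conjh (g z)) => //; rewrite cell_conjh.
Qed.

(* Two points without a common chart have a coordinate that is zero for one and
   infinite for the other; if [j] is the first one, all coordinates before [j] can
   be put in common charts, and then the [j]-th ones are inverse to each other up
   to conjugation. *)
Lemma disc_bundle_hausdorff : hausdorff_space (disc_bundle R a).
Proof.
rewrite open_hausdorff => p q pq.
have common u y z : p = cell a u y -> q = cell a u z ->
    exists2 AB : set (disc_bundle R a) * set (disc_bundle R a), (p \in AB.1 /\ q \in AB.2) &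
    [/\ open AB.1, open AB.2 & AB.1 `&` AB.2 == set0].
  move=> py qz.
  (* Within a common cell, separate the folded representatives in the vector space and pull the
     neighbourhoods back by [fold]. *)
  have /eqP yz : fold y <> fold z.
    by move=> yz; move/eqP: pq; apply; rewrite py qz -(cell_fold u y) yz cell_fold.
  have := @norm_hausdorff R 'rV[R]_m.+2; rewrite open_hausdorff => /(_ _ _ yz).
  case=> -[A B] /= [/set_mem Ay /set_mem Bz] [oA oB AB0].
  have ofold C : open C -> open (cell a u @` (fold @^-1` C)).
    by move=> oC; apply: cell_open; apply: open_comp oC => w _; exact: fold_continuous.
  exists (cell a u @` (fold @^-1` A), cell a u @` (fold @^-1` B)) => /=.
    by split; apply/mem_set; [exists y|exists z].
  split; [exact: ofold|exact: ofold|apply/eqP/seteqP; split=> // r [[w Aw <-] [w' Bw']]].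
  by move/fold_cell => E; move/eqP/seteqP: AB0 => [/(_ (fold w)) + _]; apply; split;
    rewrite // -E.
have [s [y py]] := cell_surj p; have [t [z qz]] := cell_surj q.
pose conflict k := [&& s k != t k, nrm y k == 0 & nrm z k == 0].
have [j0 cj0|noc] := pickP conflict; last first.
  (* A common cone: from [s], bits change only where [y] is non-zero; from [t], only where [y]
     vanishes and the bits differ, and there the absence of conflict makes [z] non-zero. *)
  pose u : @bott_cone m.+1 := [ffun k => if nrm y k == 0 then s k else t k].
  have [y' yE] : exists y', cell a u y' = cell a s y.
    by apply: cell_change => k; rewrite ffunE -nrm_eq0; case: (nrm y k == 0); rewrite ?eqxx.
  have [z' zE] : exists z', cell a u z' = cell a t z.
    apply: cell_change => k; rewrite ffunE -nrm_eq0; have := noc k; rewrite /conflict.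
    by case: (nrm y k == 0) => /=; rewrite ?eqxx // [t k == _]eq_sym => + st;
      rewrite st => /negbT.
  by apply: (common u y' z'); rewrite ?yE ?zE.
have [j cj jmin] := @arg_minnP _ j0 conflict (fun k => k : nat) cj0.
have {cj} /and3P[stj /eqP yj0 /eqP zj0] := cj.
pose u k := if nrm y k == 0 then s k else t k.
(* Before [j] both cones are moved to the common bits [u], as minimality of [j] permits; from [j] on
   they keep their own bits. *)
pose s' : @bott_cone m.+1 := [ffun k : 'I_m.+1 => if (k < j)%N then u k else s k].
pose t' : @bott_cone m.+1 := [ffun k : 'I_m.+1 => if (k < j)%N then u k else t k].
have [y' yE] : exists y', cell a s' y' = cell a s y.
  apply: cell_change => k; rewrite ffunE -nrm_eq0 /u; case: ifP; rewrite ?eqxx //.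
  by case: (nrm y k == 0); rewrite ?eqxx.
have [z' zE] : exists z', cell a t' z' = cell a t z.
  apply: cell_change => k; rewrite ffunE -nrm_eq0 /u; case: ifP => kj; rewrite ?eqxx //.
  case y0: (nrm y k == 0); rewrite ?eqxx // => ts.
  apply/negP => z0; have := jmin k; rewrite /conflict y0 z0 eq_sym ts => /(_ isT).
  by rewrite leqNgt kj.
have s'j : s' j = s j by rewrite ffunE ltnn.
have t'j : t' j = t j by rewrite ffunE ltnn.
have y'0 : nrm y' j = 0.
  apply/eqP; rewrite nrm_eq0 -[_ == _]negbK (cell_neq0_shared (esym yE)) ?s'j // negbK.
  by rewrite -nrm_eq0 yj0.
have z'0 : nrm z' j = 0.
  apply/eqP; rewrite nrm_eq0 -[_ == _]negbK (cell_neq0_shared (esym zE)) ?t'j // negbK.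
  by rewrite -nrm_eq0 zj0.
exists (cell a s' @` [set w | nrm w j < 1], cell a t' @` [set w | nrm w j < 1]) => /=.
  by split; apply/mem_set; [exists y'; rewrite /= ?y'0 ?py|exists z'; rewrite /= ?z'0 ?qz].
split; [exact/cell_open/open_nrm_lt1|exact/cell_open/open_nrm_lt1|].
apply/eqP/seteqP; split=> // r [[w /= w1 <-] [w' /= w'1 ww']].
have := nrm_cell (i := j) (esym ww').
rewrite s'j t'j (negPf stj) => E.
have {}E : nrm w j * nrm w' j = 1.
  by apply: E => k kj; rewrite !ffunE kj.
have := mulr_ilt1 (nrm_ge0 w j) (nrm_ge0 w' j) w1 w'1.
by rewrite E ltxx.
Qed.

Lemma disc_bundle_second_countable : @second_countable (disc_bundle R a).
Proof.
have [B cB [oB bB]] := @second_countable_rV R m.+2.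
exists (\bigcup_(s in [set: @bott_cone m.+1]) ((fun O => cell a s @` O) @` B)).
  apply: bigcup_countable => [|s _]; first exact: countableP.
  exact: sub_countable (card_image_le _ B) cB.
split; first by move=> _ [s _ [D BD <-]]; apply: cell_open; exact: oB.
move=> p V NV; have [s [y py]] := cell_surj p.
have : nbhs y (cell a s @^-1` V) by apply: cell_continuous; rewrite -py.
move/(bB y) => [D [BD Dy] DV].
exists (cell a s @` D); first by split; [exists s => //; exists D|exists y].
by move=> _ [z Dz <-]; exact: DV.
Qed.

(** Treat the coordinates in increasing order: one of modulus above 1 is inverted by flipping its
    bit, which leaves the earlier moduli unchanged by triangularity. Finitely many compact cubes
    therefore cover W. *)
Lemma cell_unit_box (p : disc_bundle R a) : exists s y, p = cell a s y /\ forall i, nrm y i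
  <= 1.
Proof.
suff /(_ m.+1 (leqnn _)) [s [y [py y1]]] : forall l, (l <= m.+1)%N ->
    exists s y, p = cell a s y /\ forall i, (i < l)%N -> nrm y i <= 1.
  by exists s, y; split=> // i; exact: y1.
elim=> [_|l IH lm]; first by have [s [y py]] := cell_surj p; exists s, y.
have [s [y [py y1]]] := IH (ltnW lm).
pose j : 'I_m.+1 := Ordinal lm.
have lj (i : 'I_m.+1) : (i < l.+1)%N -> (i < l)%N \/ i = j.
  by rewrite ltnS leq_eqVlt => /orP[/eqP il|]; [right; apply/val_inj|left].
have [yj|yj] := lerP (nrm y j) 1.
  by exists s, y; split=> // i /lj[/y1//|->].
have yj0 : cplx y ord0 j != 0 by rewrite -nrm_eq0 gt_eqF // (lt_trans ltr01).
have [z zy] : exists z, cell a (flip_at s j) z = cell a s y.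
  by apply: cell_change => k; rewrite flip_atE => /eqP ->.
have same k : k != j -> s k = flip_at s j k.
  by move=> kj; apply/eqP; rewrite -[_ == _]negbK flip_atE.
exists (flip_at s j), z; split; first by rewrite zy.
move=> i /lj[il|->].
  have ij : i != j by rewrite -val_eqE /= ltn_eqF.
  have := nrm_cell (i := i) (esym zy); rewrite -same // eqxx => ->; first exact: y1.
  by move=> k ki; apply: same; rewrite -val_eqE /= ltn_eqF // (ltn_trans ki).
have := nrm_cell (i := j) (esym zy); rewrite -[s j == _]negbK flip_atE eqxx /= => E.
have {}E : nrm y j * nrm z j = 1.
  by apply: E => k kj; apply: same; rewrite -val_eqE /= ltn_eqF.
rewrite leNgt; apply/negP => z1.
by have := mulr_egt1 yj z1; rewrite E ltxx.
Qed.

Lemma disc_bundle_compact : compact [set: disc_bundle R a].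
Proof.
pose K : set 'rV[R]_m.+2 :=
  [set y : 'rV[R]_m.+2 | forall k : 'I_m.+2, `[-1, 1]%classic (y ord0 k)].
have cK : compact K by apply: (@rV_compact R _ (fun=> `[-1, 1]%classic)) => _;
  exact: segment_compact.
have -> : [set: disc_bundle R a] = \big[setU/set0]_(s : @bott_cone m.+1) (cell a s @` K).
  apply/seteqP; split=> // p _; have [s [y [-> y1]]] := cell_unit_box p.
  rewrite (bigD1 s) //=; left; exists y => // k.
  have sq1 (r w : R) : r ^+ 2 + w ^+ 2 <= 1 -> `[-1, 1]%classic r.
    by move=> rw; rewrite /= in_itv /=; apply/andP; split; nra.
  case: (unliftP ord0 k) => [i ->|->].
    by have := y1 i; rewrite /nrm mxE; exact: sq1.
  by have := y1 ord_max; rewrite /nrm mxE eqxx /sqnorm /= addrC; exact: sq1.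
apply: (big_ind (@compact (disc_bundle R a))) => [|A B cA cB|s _].
- exact: compact0.
- exact: compactU.
- apply: continuous_compact cK; apply: continuous_subspaceT; exact: cell_continuous.
Qed.

End Orientable.
End Cells.

(** * Oriented charts of the disc bundle *)

Section SignMatrix.
Context {R : realType} {n : nat}.

(** In the charts of W the last coordinate differs from the leading [h], so the half-space is
    preserved; dropping [h] turns this matrix into its analogue one dimension lower. *)
Definition sign_mx (e : R) : 'M[R]_n.+1 := diag_mx (\row_i if i == ord_max then e else 1).

Lemma mul_sign_mxE (x : 'rV[R]_n.+1) e i :
  (x *m sign_mx e) ord0 i = x ord0 i * if i == ord_max then e else 1.
Proof. by rewrite mul_mx_diag !mxE. Qed.

Lemma sign_mxK e : e * e = 1 -> sign_mx e *m sign_mx e = 1%:M.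
Proof.
move=> ee; apply/row_matrixP => k; rewrite !rowE mulmx1 mulmxA; apply/rowP => i.
by rewrite !mul_sign_mxE -mulrA; case: ifP; rewrite ?ee !mulr1.
Qed.

Lemma det_sign_mx e : \det (sign_mx e) = e.
Proof.
rewrite det_diag (bigD1 ord_max) //= mxE eqxx big1 ?mulr1 // => i im.
by rewrite mxE (negPf im).
Qed.

End SignMatrix.

Section LocalExprMulmx.
Context {R : realType} {n : nat}.

Lemma local_expr_eq (T : Type) (m : nat) (D D' : set T) (a a' : T -> 'rV[R]_n)
    (b b' : T -> 'rV[R]_m) p U g :
  D' `<=` D -> D' p -> (forall q, D' q -> a q = a' q) -> (forall q, D' q -> b q = b' q) ->
  local_expr D a b p U g -> local_expr D' a' b' p U g.
Proof.
move=> DD Dp aE bE [oU Up Cg gE]; split=> //; first by rewrite -aE.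
by move=> q Dq; rewrite -aE // -bE // => Uq; rewrite gE //; exact: DD.
Qed.

Lemma local_expr_pullback (T S : Type) (m : nat) (k : S -> T) (D : set T) (a : T -> 'rV[R]_n)
    (b : T -> 'rV[R]_m) q U g :
  local_expr D a b (k q) U g -> local_expr (k @^-1` D) (a \o k) (b \o k) q U g.
Proof. by move=> [oU Up Cg gE]; split=> // r Dr Ur; exact: gE. Qed.

Lemma local_expr_mulmx (T : Type) (m : nat) (D : set T) (a : T -> 'rV[R]_n)
    (b : T -> 'rV[R]_m) p U g (M M' : 'M[R]_n) (N : 'M[R]_m) :
  M *m M' = 1%:M -> local_expr D a b p U g ->
  local_expr D (fun q => a q *m M) (fun q => b q *m N) p
    ((fun z => z *m M') @^-1` U) (fun z => g (z *m M') *m N).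
Proof.
move=> MM [oU Up Cg gE].
have oU' : open ((fun z => z *m M') @^-1` U).
  apply: open_comp oU => z _; apply: differentiable_continuous.
  exact: (jacobian_mulmxr M' z).1.
split=> //.
- by rewrite /preimage /= -mulmxA MM mulmx1.
- apply: (@Cinfty_comp R _ _ _ _ setT (fun z => g (z *m M')) (fun z =>
  z *m N) oU' openT) => //.
    apply: (Cinfty_comp oU' oU _ _ Cg) => //.
    exact: Cinfty_mulmxr.
  exact: Cinfty_mulmxr openT.
- by move=> q Dq; rewrite /preimage /= -mulmxA MM mulmx1 => Uq; rewrite gE.
Qed.

End LocalExprMulmx.

Lemma det_mul3_gt0 (R : realDomainType) (n : nat) (A B C M N : 'M[R]_n) (e e' : R) :
  \det M = e -> \det N = e' -> B = M *m C -> A = B *m N -> 0 < e * e' * \det C -> 0 < \det A.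
Proof. by move=> <- <- -> ->; rewrite !det_mulmx mulrAC. Qed.

Lemma positive_at_sign (R : realType) (T : Type) (n : nat) (D : set T)
    (a b : T -> 'rV[R]_n.+1) p (e e' : R) : e * e = 1 ->
  signed_at (e * e') D a b p ->
  positive_at D (fun q => a q *m sign_mx e) (fun q => b q *m sign_mx e') p.
Proof.
move=> ee [U [g [E d]]]; have E' := local_expr_mulmx (sign_mx e') (sign_mxK (n := n) ee) E.
exists ((fun z => z *m sign_mx e) @^-1` U), (fun z => g (z *m sign_mx e) *m sign_mx e').
split; first exact: E'.
case: E => oU Up Cg gE.
have az : a p *m sign_mx e *m sign_mx e = a p by rewrite -mulmxA sign_mxK // mulmx1.
pose L (M : 'M[R]_n.+1) (z : 'rV[R]_n.+1) := z *m M.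
have dL M z : differentiable (L M) z by exact: (jacobian_mulmxr M z).1.
have JL M z : jacobian (L M) z = M by exact: (jacobian_mulmxr M z).2.
have dg : differentiable g (L (sign_mx e) (a p *m sign_mx e)).
  by rewrite /L az; exact: Cinfty_differentiable Cg Up.
have dgL : differentiable (g \o L (sign_mx e)) (a p *m sign_mx e)
  by exact: differentiable_comp.
have J1 := jacobian_comp (dL _ _) dg.
have J2 := jacobian_comp dgL (dL (sign_mx e') _).
have E1 := etrans J1 (congr2 mulmx (JL _ _) (congr1 (jacobian g) az)).
have E2 := etrans J2 (congr1 (mulmx _) (JL _ _)).
exact: det_mul3_gt0 (det_sign_mx e) (det_sign_mx e') E1 E2 d.
Qed.

Section Charts.
Variables (R : realType) (m : nat) (a : 'M[int]_m.+1).
Implicit Types (s t u : @bott_cone m.+1) (y z : 'rV[R]_m.+2) (x : 'rV[R]_m.+1) (i j k :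
  'I_m.+1).
Variable eps : @bott_cone m.+1 -> R.
Hypothesis eps1 : forall s, eps s = 1 \/ eps s = -1.
Hypothesis eps_flip : forall s j x, x ord0 j != 0 ->
  0 < eps s * eps (flip_at s j) * \det (jacobian (coord_change a s (flip_at s j)) x).

Definition disc_coord s (p : disc_bundle R a) : 'rV[R]_m.+2 :=
  xget 0 [set y | cell a s y = p /\ y ord0 ord0 <= 0].

Lemma disc_coord_cell s y : disc_coord s (cell a s y) = fold y.
Proof.
rewrite /disc_coord; case: xgetP => [z _ [/fold_cell <- z0]|/(_ (fold y)) []].
  by rewrite fold_id.
by split; [exact: cell_fold|exact: fold_le0].
Qed.

Definition disc_chart s : chart R (disc_bundle R a) m.+2 :=
  Chart (range (cell a s)) (fun p => disc_coord s p *m sign_mx (eps s)).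

Definition disc_atlas : set (chart R (disc_bundle R a) m.+2) := range disc_chart.

Lemma mul_sign_mx0 y e : (y *m sign_mx e) ord0 ord0 = y ord0 ord0.
Proof. by rewrite mul_sign_mxE mulr1. Qed.

Lemma sign_mx_epsK s n : sign_mx (n := n) (eps s) *m sign_mx (eps s) = 1%:M.
Proof. by apply: sign_mxK; exact: eps_sqr. Qed.

Lemma mul_sign_mxK s n (y : 'rV[R]_n.+1) : y *m sign_mx (eps s) *m sign_mx (eps s) = y.
Proof. by rewrite -mulmxA sign_mx_epsK mulmx1. Qed.

Lemma mulmx_continuous (n p : nat) (M : 'M[R]_(n, p)) : continuous (fun z : 'rV[R]_n =>
  z *m M).
Proof. by move=> z; apply: differentiable_continuous; exact: (jacobian_mulmxr M z).1. Qed.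

(** [disc_coord s] after [cell a s] is the continuous map [fold], and [cell a s] is open. *)
Lemma disc_coord_continuous s y : {for cell a s y, continuous (disc_coord s)}.
Proof.
move=> V; rewrite /= disc_coord_cell => NV.
move: NV; rewrite nbhsE => -[W [oW Wy] WV].
have oD : open (cell a s @` (@fold R m @^-1` W)).
  apply: (cell_open eps1 eps_flip); apply: open_comp oW => z _; exact: fold_continuous.
apply: filterS (open_nbhs_nbhs (conj oD _)); last by exists y.
by move=> _ [z Wz <-]; apply: WV; rewrite /= disc_coord_cell.
Qed.

Lemma disc_chart_is_chart s : is_chart (@half_space R m.+1) (disc_chart s).
Proof.
split=> /=.
- by apply: (cell_open eps1 eps_flip); exact: openT.
- move=> p q /set_mem[y _ <-] /set_mem[z _ <-] /= /(congr1 (mulmx^~ (sign_mx (eps s)))).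
  by rewrite !mul_sign_mxK !disc_coord_cell => yz; rewrite -(cell_fold a s y) yz cell_fold.
- move=> _ [y _ <-].
  apply: (@continuous_comp _ _ _ (disc_coord s) (fun z => z *m sign_mx (eps s))).
    exact: disc_coord_continuous.
  exact: mulmx_continuous.
- move=> V oV Vs.
  (* The inverse of the chart extends continuously from the half-space to the whole vector space;
     [V] is pulled back along this extension. *)
  exists ((fun y => cell a s (y *m sign_mx (eps s))) @^-1` V).
    apply: open_comp oV => y _.
    by apply: (@continuous_comp _ _ _ (fun y => y *m sign_mx (eps s)) (cell a s));
      [exact: mulmx_continuous|exact: cell_continuous].
  apply/seteqP; split=> [_ [p Vp <-]|y [Vy y0]].
    have [y _ yp] := Vs p Vp; move: Vp; rewrite -yp /= disc_coord_cell => Vp.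
    split; first by rewrite /preimage /= mul_sign_mxK cell_fold.
    by rewrite /half_space /= mul_sign_mx0; exact: fold_le0.
  exists (cell a s (y *m sign_mx (eps s))) => //=.
  by rewrite disc_coord_cell fold_id ?mul_sign_mxK // mul_sign_mx0.
Qed.

Lemma disc_atlas_oriented : oriented_atlas (@half_space R m.+1) disc_atlas.
Proof.
split.
- by move=> _ [s _ <-]; exact: disc_chart_is_chart.
- move=> p; have [s [y ->]] := cell_surj p.
  by exists (disc_chart s); [exists s|exists y].
move=> _ _ [s _ <-] [t _ <-] p [[y0 _ yp] [z0 _ zp]].
pose y := fold y0.
have yE : cell a s y = p by rewrite cell_fold.
have dy : disc_coord s p = y by rewrite -yp disc_coord_cell.
have [U [g [oU Uy Cg gE dg]]] := germ_cell eps1 eps_flip (etrans yE (esym zp)).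
apply: positive_at_sign; first exact: eps_sqr.
exists U, g; split; last by rewrite dy.
split=> //; first by rewrite dy.
move=> q [[w0 _ wq] _] Uq.
pose w := fold w0.
have wE : cell a s w = q by rewrite cell_fold.
have dw : disc_coord s q = w by rewrite -wq disc_coord_cell.
(* [g] scales [h] by a positive factor, so [g w] remains in the half-space and is the coordinate
   vector itself rather than its conjugate. *)
rewrite dw in Uq *; have [gw [c c0 gw0]] := gE w Uq.
rewrite -wE -gw disc_coord_cell fold_id // gw0.
by rewrite mulr_ge0_le0 ?(ltW c0) // fold_le0.
Qed.

(** * The boundary of the disc bundle *)

Lemma cell_boundary s y t z : cell a s y = cell a t z -> z ord0 ord0 = 0 -> y ord0 ord0 = 0.
Proof.
move=> yz z0; have [U [g [oU Uy Cg gE dg]]] := germ_cell eps1 eps_flip yz.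
have [gy [c c0 gy0]] := gE y Uy.
have : g y ord0 ord0 = 0.
  by have /cell_inj[->|->] := etrans (esym yz) (esym gy); rewrite /conjh ?hcons0 z0 ?oppr0.
by rewrite gy0 => /eqP; rewrite mulf_eq0 (gt_eqF c0) => /eqP.
Qed.

Lemma boundaryP (p : disc_bundle R a) : boundary disc_atlas p <-> exists s x, p = cell a s
  (hcons 0 x).
Proof.
split=> [[_ [[s _ <-] [y _ <-]]]|[s [x ->]]].
  rewrite /= mul_sign_mx0 disc_coord_cell hcons0 => /eqP.
  rewrite oppr_eq0 normr_eq0 => /eqP y0; exists s, (base y).
  by rewrite -[in LHS](hcons_base y) y0.
exists (disc_chart s); split; [by exists s|by exists (hcons 0 x)|].
by rewrite /= mul_sign_mx0 disc_coord_cell !hcons0 normr0 oppr0.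
Qed.

(** [repr] picks an arbitrary representative; [cell_real] makes the result independent of it. *)
Definition bott_to_disc (p : real_bott R a) : disc_bundle R a :=
  cell a (tag (repr p)) (hcons 0 (tagged (repr p))).

Lemma bott_to_disc_affine s x : bott_to_disc (affine_chart a s x) = cell a s (hcons 0 x).
Proof.
apply/(cell_real a _ _ s x).
have := reprK (affine_chart a s x).
by case: (repr _) => t x'.
Qed.

Lemma bott_to_disc_inj : injective bott_to_disc.
Proof.
move=> p q; have [s [x ->]] := affine_chart_surj p; have [t [x' ->]] := affine_chart_surj q.
by rewrite !bott_to_disc_affine => /cell_real.
Qed.

Lemma bott_to_disc_boundary p : bott_to_disc p \in boundary disc_atlas.
Proof.
apply/mem_set/boundaryP; have [s [x ->]] := affine_chart_surj p.
by exists s, x; rewrite bott_to_disc_affine.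
Qed.

Lemma bott_to_disc_surj (q : set_type (boundary disc_atlas)) : exists p, bott_to_disc p =
  set_val q.
Proof.
have /boundaryP[s [x qx]] := set_valP q.
by exists (affine_chart a s x); rewrite bott_to_disc_affine; exact: esym qx.
Qed.

Definition bott_to_bd p : set_type (boundary disc_atlas) := SigSub (bott_to_disc_boundary p).

Definition bd_to_bott q : real_bott R a := sval (cid (bott_to_disc_surj q)).

Lemma bott_to_bdE p : set_val (bott_to_bd p) = bott_to_disc p.
Proof. by []. Qed.

Lemma bd_to_bottE q : bott_to_disc (bd_to_bott q) = set_val q.
Proof. exact: svalP (cid (bott_to_disc_surj q)). Qed.

Lemma bott_to_bdK : cancel bott_to_bd bd_to_bott.
Proof. by move=> p; apply: bott_to_disc_inj; rewrite bd_to_bottE. Qed.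

Lemma bd_to_bottK : cancel bd_to_bott bott_to_bd.
Proof. by move=> q; apply: val_inj; exact: bd_to_bottE. Qed.

Lemma bott_to_disc_cell p s y : bott_to_disc p = cell a s y ->
  p = affine_chart a s (base y) /\ y = hcons 0 (base y).
Proof.
have [t [x ->]] := affine_chart_surj p; rewrite bott_to_disc_affine => E.
have y0 : y ord0 ord0 = 0 by apply: cell_boundary (esym E) _; rewrite hcons0.
have yE : y = hcons 0 (base y) by rewrite -[LHS]hcons_base y0.
by split=> //; apply/cell_real; rewrite -yE.
Qed.

Lemma bott_to_bd_continuous : continuous bott_to_bd.
Proof.
have cF : continuous bott_to_disc.
  apply: real_bott_continuous => s.
  have -> : bott_to_disc \o affine_chart a s = cell a s \o hcons 0.
    by apply/funext => x; rewrite /= bott_to_disc_affine.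
  move=> x; apply: continuous_comp; last exact: cell_continuous.
  by apply: (@continuous_hcons _ _ _ (fun=> 0) id) => //; exact: cst_continuous.
apply/continuousP => V [W oW <-].
by move/continuousP: cF => /(_ W oW).
Qed.

Lemma bd_to_bott_continuous : continuous bd_to_bott.
Proof.
apply/continuousP => V oV.
(* The subspace topology asks for an open set of the whole disc bundle: take the points whose base
   lies in [V], whatever their [h]. On the boundary [h] is 0, and [bott_to_disc_cell] recovers
   [V]. *)
pose W := \bigcup_s (cell a s @` [set y | V (affine_chart a s (base y))]).
exists W.
  apply: bigcup_open => s _; apply: (cell_open eps1 eps_flip).
  apply: (@open_comp _ _ (affine_chart a s \o @base R m)) => // y _.
  by apply: continuous_comp; [exact: base_continuous|exact: affine_chart_continuous].
apply/seteqP; split=> q /=.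
  move=> [s _ [y Vy yq]].
  have [-> _] : bd_to_bott q = affine_chart a s (base y) /\ y = hcons 0 (base y).
    by apply: bott_to_disc_cell; rewrite bd_to_bottE.
  exact: Vy.
have [s [x qx]] := affine_chart_surj (bd_to_bott q).
move=> Vq; exists s => //; exists (hcons 0 x); first by rewrite /= base_hcons -qx.
by rewrite -bott_to_disc_affine -qx bd_to_bottE.
Qed.

Lemma bott_chart_affine s x : bott_chart R a s (affine_chart a s x) = x.
Proof.
rewrite /bott_chart /=; case: xgetP => [z _ /affine_chart_inj //|/(_ x) []//].
Qed.

Lemma base_sign_mx y (e : R) : base (y *m sign_mx e) = base y *m sign_mx e.
Proof.
apply/rowP => i; rewrite mxE !mul_sign_mxE mxE.
have -> // : (lift ord0 i == ord_max :> 'I_m.+2) = (i == ord_max).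
by rewrite -[LHS]val_eqE /= /bump /= add1n eqSS.
Qed.

Lemma boundary_chartE s p : cdom (boundary_chart disc_atlas (disc_chart s)) (bott_to_bd p) ->
  range (affine_chart a s) p /\
  boundary_chart disc_atlas (disc_chart s) (bott_to_bd p) = bott_chart R a s p *m sign_mx
    (eps s).
Proof.
move=> [y _ yp].
have [-> yE] := bott_to_disc_cell (esym yp).
split; first by exists (base y).
rewrite bott_chart_affine -base_sign_mx; congr (base (_ *m _)).
by rewrite bott_to_bdE bott_to_disc_affine -yE disc_coord_cell fold_id // yE hcons0.
Qed.

End Charts.

(** * Signs of the affine charts in the given orientation *)

Section Orientation.
Variables (R : realType) (m : nat) (a : 'M[int]_m.+1) (A : set (chart R (real_bott R a) m.+1)).
Implicit Types (s t : @bott_cone m.+1) (x : 'rV[R]_m.+1) (j : 'I_m.+1).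
Hypothesis orA : orientation [set: 'rV[R]_m.+1] (bott_atlas R a) A.

Lemma bott_chart_is_chart s : is_chart setT (bott_chart R a s).
Proof. by case: orA => _ [h _ _]; apply: h; left; exists s. Qed.

Lemma bott_smooth s c p : A c -> (cdom c `&` cdom (bott_chart R a s)) p ->
  smooth_at (cdom c `&` cdom (bott_chart R a s)) c (bott_chart R a s) p /\
  smooth_at (cdom c `&` cdom (bott_chart R a s)) (bott_chart R a s) c p.
Proof.
case: orA => _ [_ _ h] Ac Dp.
have Bs : (bott_atlas R a `|` A) (bott_chart R a s) by left; exists s.
have Bc : (bott_atlas R a `|` A) c by right.
split; first exact: (h _ _ Bc Bs).
by rewrite setIC; apply: (h _ _ Bs Bc); rewrite setIC.
Qed.

Lemma bott_sign_exists s : exists e : R, (e = 1 \/ e = -1) /\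
  forall p, range (affine_chart a s) p -> has_sign A (bott_chart R a s) e p.
Proof.
have [oA _] := orA.
have [||||e e1 es] := @has_sign_const R _ _ A (bott_chart R a s) oA (bott_chart_is_chart s) _ _
  (affine_chart a s).
- by move=> c p Ac Dp; exact: (bott_smooth Ac Dp).1.
- by move=> c p Ac Dp; exact: (bott_smooth Ac Dp).2.
- exact: affine_chart_continuous.
- by [].
by exists e.
Qed.

(** Supplies the hypothesis [eps_flip]: the coordinate change is a local expression between two
    affine charts whose signs are known. *)
Lemma bott_sign_flip (eps : @bott_cone m.+1 -> R) :
  (forall s p, range (affine_chart a s) p -> has_sign A (bott_chart R a s) (eps s) p) ->
  forall s j x, x ord0 j != 0 ->
  0 < eps s * eps (flip_at s j) * \det (jacobian (coord_change a s (flip_at s j)) x).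
Proof.
move=> es s j x xj; have [oA [_ _ sm]] := orA.
set t := flip_at s j; set p := affine_chart a s x.
have glue x' : x' ord0 j != 0 ->
  affine_chart a t (coord_change a s t x') = affine_chart a s x'.
  move=> x'j; apply/esym/(@eqmodP _ (bott_glue_equiv a R))/bott_glueP; split=> //= k.
  by rewrite flip_atE => /eqP->.
have sp : range (affine_chart a s) p by exists x.
have tp : range (affine_chart a t) p by exists (coord_change a s t x) => //; exact: glue.
have Bs : (bott_atlas R a `|` A) (bott_chart R a s) by left; exists s.
have Bt : (bott_atlas R a `|` A) (bott_chart R a t) by left; exists t.
have E : local_expr (cdom (bott_chart R a s) `&` cdom (bott_chart R a t))
    (bott_chart R a s) (bott_chart R a t) p [set x | x ord0 j != 0] (coord_change a s t).
  split.
  - exact: open_coord_neq0.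
  - by change (bott_chart R a s p ord0 j != 0); rewrite /p bott_chart_affine.
  - exact: Cinfty_coord_change_flip.
  - move=> q [[x' _ <-] _]; rewrite bott_chart_affine => x'j.
    by rewrite -glue // bott_chart_affine.
have sm' : smooth_at (cdom (bott_chart R a s) `&` cdom (bott_chart R a t))
    (bott_chart R a t) (bott_chart R a s) p.
  by rewrite setIC; exact: (sm _ _ Bt Bs p (conj tp sp)).
have := has_sign_transition oA (bott_chart_is_chart s) (bott_chart_is_chart t) sp tp
  (es s p sp) (es t p tp) E sm'.
by rewrite /p bott_chart_affine.
Qed.

End Orientation.

Theorem corollary5p7 (R : realType) (n : nat) (C : 'M['F_2]_n) (a : 'M[int]_n)
    (A : set (chart R (real_bott R a) n)) :
  (1 <= n)%N ->
  bott_matrix C ->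
  integral_lift C a ->
  orientation [set: 'rV[R]_n] (bott_atlas R a) A ->
  oriented_null_cobordant A.
Proof.
case: n C a A => // m C a A _ _ _ orA.
have [eps epsP] := choice (bott_sign_exists orA).
have eps1 s : eps s = 1 \/ eps s = -1 := (epsP s).1.
have epsA s : forall p, range (affine_chart a s) p ->
  has_sign A (bott_chart R a s) (eps s) p :=
  (epsP s).2.
have epsF := bott_sign_flip orA epsA.
exists (disc_bundle R a), (@disc_atlas R m a eps); split.
- exact: disc_bundle_hausdorff eps1 epsF.
- exact: disc_bundle_second_countable eps1 epsF.
- exact: disc_bundle_compact eps1 epsF.
- exact: disc_atlas_oriented eps1 epsF.
exists (@bott_to_bd R m a eps), (@bd_to_bott R m a eps); split.
- exact: bott_to_bdK.
- exact: bd_to_bottK.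
- exact: bott_to_bd_continuous.
- exact: bd_to_bott_continuous eps1 epsF.
move=> c1 _ Ac1 [_ [s _ <-] <-] D1 D2.
set c2 := boundary_chart _ _ in D1 D2 *.
have D1E p : D1 p -> (cdom c1 `&` cdom (bott_chart R a s)) p /\
    c2 (bott_to_bd eps p) = bott_chart R a s p *m sign_mx (eps s).
  by move=> [c1p /(boundary_chartE eps1 epsF)[sp c2E]].
have gD q : D2 q -> D1 (bd_to_bott q).
  by move=> [c2q c1q]; split=> //; rewrite /preimage /= bd_to_bottK.
split.
- move=> p Dp; have [[c1p sp] _] := D1E p Dp.
  (* The chart [c1] belongs to the given orientation, so its sign is 1, and [sign_mx 1] is the
     identity. *)
  have sgn : signed_at (1 * eps s) (cdom c1 `&` cdom (bott_chart R a s)) c1 (bott_chart R a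
    s) p.
    by rewrite mul1r; exact: epsA.
  have [U [g [E d]]] := positive_at_sign (mulr1 1) sgn.
  have m1 (x : 'rV[R]_m.+1) : x *m sign_mx 1 = x.
    by apply/rowP => i; rewrite mul_sign_mxE if_same mulr1.
  exists U, g; split; last by move: d; rewrite m1.
  apply: local_expr_eq E => //.
  + by move=> q /D1E[].
  + by move=> q /D1E[_ c2E]; exact: esym c2E.
- move=> q Dq; have [Dp _] := D1E _ (gD q Dq).
  have [_ [U [h E]]] := bott_smooth orA Ac1 Dp.
  (* Here the source is the boundary chart, corrected by its involutive sign matrix, while the
     target [c1] is left as it is, whence the identity matrix. *)
  have E' := local_expr_mulmx 1%:M (sign_mx_epsK eps1 s m) (local_expr_pullback E).
  exists ((fun z => z *m sign_mx (eps s)) @^-1` U), (fun z =>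
    h (z *m sign_mx (eps s)) *m 1%:M).
  apply: (local_expr_eq _ Dq _ _ E').
  + by move=> r /gD/D1E[].
  + by move=> r /gD/D1E[_ <-]; rewrite bd_to_bottK.
  + by move=> r _; rewrite /= mulmx1.
Qed.
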